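(* Let $I$ be a compact interval in $\mathbb{R}$ with coordinate $s$, and let $\phi_0:I\to S^6$ and $\psi_0:I\to\mathbb{R}^7$ be real analytic maps (real analytic on an open set containing $I$). Then there exist $\epsilon>0$ and unique real analytic maps $\phi:I\times(-\epsilon,\epsilon)\to S^6$ and $\psi:I\times(-\epsilon,\epsilon)\to\mathbb{R}^7$ with $\phi(s,0)=\phi_0(s)$, $\psi(s,0)=\psi_0(s)$ for all $s\in I$ and $$\frac{\partial\phi}{\partial t}=\phi\times\frac{\partial\phi}{\partial s},\qquad \frac{\partial\psi}{\partial t}=\phi\times\frac{\partial\psi}{\partial s},$$ where $t$ is the coordinate on $(-\epsilon,\epsilon)$. Moreover $M=\{r\phi(s,t)+\psi(s,t):r\in\mathbb{R},s\in I,t\in(-\epsilon,\epsilon)\}$ is an r-oriented ruled associative 3-fold in $\mathbb{R}^7$.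
   Context: Let $(x_1,\dots,x_7)$ be coordinates on $\mathbb{R}^7$ with Euclidean metric $g$, $dx_{ijk}=dx_i\wedge dx_j\wedge dx_k$, and $\varphi=dx_{123}+dx_{145}+dx_{167}+dx_{246}-dx_{257}-dx_{347}-dx_{356}$. The cross product $\times$ on $\mathbb{R}^7$ is defined by $g(u\times v,w)=\varphi(u,v,w)$. An oriented 3-dimensional (immersed) submanifold $N$ is associative if $\varphi|_{T_xN}=\mathrm{vol}_{T_xN}$ for all $x\in N$. A 3-dimensional submanifold written as $\{r\phi(\sigma)+\psi(\sigma)\}$ with $\phi$ valued in $S^6$ is r-oriented ruled: it is a union of affine lines $\{r\phi(\sigma)+\psi(\sigma):r\in\mathbb{R}\}$ parametrised by $\sigma$, each oriented by the unit direction $\phi(\sigma)$, this orientation varying smoothly.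
   Formalization: That M is a 3-fold fails for degenerate data (constant φ_0, ψ_0 give a line); instead |φ|=1 and the associative condition φ=vol on the (r,s,t)-tangent vectors is proved at every point, trivial where the parametrisation is not an immersion. I is taken with nonempty interior. *)

(* Defs.v *)
From Stdlib Require Import Reals Lra Lia.
From Coquelicot Require Import Coquelicot.
Open Scope R_scope.

(* Vectors of R^7: only components 0..6 (x_1..x_7) are meaningful. *)
Definition Vec := nat -> R.
Definition veq (u v : Vec) : Prop := forall i : nat, (i < 7)%nat -> u i = v i.

Definition dot7 (u v : Vec) : R := sum_f_R0 (fun i => u i * v i) 6.
Definition norm7 (u : Vec) : R := sqrt (dot7 u u).

(* dx_{ijk}(u,v,w), with 1-based indices i,j,k as in the paper *)
Definition det3 (a1 a2 a3 b1 b2 b3 c1 c2 c3 : R) : R :=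
  a1 * (b2 * c3 - b3 * c2) - a2 * (b1 * c3 - b3 * c1) + a3 * (b1 * c2 - b2 * c1).
Definition dx (i j k : nat) (u v w : Vec) : R :=
  det3 (u (i-1)%nat) (u (j-1)%nat) (u (k-1)%nat)
       (v (i-1)%nat) (v (j-1)%nat) (v (k-1)%nat)
       (w (i-1)%nat) (w (j-1)%nat) (w (k-1)%nat).

Definition G2phi (u v w : Vec) : R :=
  dx 1 2 3 u v w + dx 1 4 5 u v w + dx 1 6 7 u v w + dx 2 4 6 u v w
  - dx 2 5 7 u v w - dx 3 4 7 u v w - dx 3 5 6 u v w.

Definition basis7 (k : nat) : Vec := fun i => if Nat.eqb i k then 1 else 0.

(* cross product: g(u x v, w) = phi(u,v,w), i.e. (u x v)_k = phi(u,v,e_k) *)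
Definition cross7 (u v : Vec) : Vec := fun k => G2phi u v (basis7 k).

Definition vol3 (u v w : Vec) : R :=
  sqrt (det3 (dot7 u u) (dot7 u v) (dot7 u w)
             (dot7 v u) (dot7 v v) (dot7 v w)
             (dot7 w u) (dot7 w v) (dot7 w w)).

Definition analytic1_at (f : R -> R) (x0 : R) : Prop :=
  exists (c : nat -> R) (rho : R), 0 < rho /\
    forall x, Rabs (x - x0) < rho -> is_series (fun n => c n * (x - x0) ^ n) (f x).

Definition analytic2_at (f : R -> R -> R) (x0 y0 : R) : Prop :=
  exists (c : nat -> nat -> R) (rho : R), 0 < rho /\
    forall x y, Rabs (x - x0) < rho -> Rabs (y - y0) < rho ->
      (forall n, ex_series (fun m => Rabs (c m n) * Rabs (x - x0) ^ m * Rabs (y - y0) ^ n)) /\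
      ex_series (fun n => Series (fun m => Rabs (c m n) * Rabs (x - x0) ^ m * Rabs (y - y0) ^ n)) /\
      f x y = Series (fun n => Series (fun m => c m n * (x - x0) ^ m * (y - y0) ^ n)).

(* A map is real analytic on a set D iff it is real analytic at each point
   of D (equivalently: on an open set containing D). *)
Definition vanalytic1_on (D : R -> Prop) (f : R -> Vec) : Prop :=
  forall x, D x -> forall i, (i < 7)%nat -> analytic1_at (fun x' => f x' i) x.

Definition vanalytic2_on (D : R -> R -> Prop) (f : R -> R -> Vec) : Prop :=
  forall x y, D x y -> forall i, (i < 7)%nat -> analytic2_at (fun x' y' => f x' y' i) x y.

Definition Ds (f : R -> R -> Vec) (s t : R) : Vec := fun i => Derive (fun s' => f s' t i) s.
Definition Dt (f : R -> R -> Vec) (s t : R) : Vec := fun i => Derive (fun t' => f s t' i) t.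

Definition dom (a b eps : R) (s t : R) : Prop := a <= s <= b /\ - eps < t < eps.

Definition flow_eqs (a b eps : R) (phi psi : R -> R -> Vec) : Prop :=
  forall s t, dom a b eps s t ->
    veq (Dt phi s t) (cross7 (phi s t) (Ds phi s t)) /\
    veq (Dt psi s t) (cross7 (phi s t) (Ds psi s t)).

Definition is_solution (a b eps : R) (phi0 psi0 : R -> Vec) (phi psi : R -> R -> Vec) : Prop :=
  vanalytic2_on (dom a b eps) phi /\ vanalytic2_on (dom a b eps) psi /\
  (forall s t, dom a b eps s t -> norm7 (phi s t) = 1) /\
  (forall s, a <= s <= b -> veq (phi s 0) (phi0 s) /\ veq (psi s 0) (psi0 s)) /\
  flow_eqs a b eps phi psi.

Definition ruledF (phi psi : R -> R -> Vec) (r s t : R) : Vec :=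
  fun i => r * phi s t i + psi s t i.

(* M is associative: at every point, with the orientation given by the
   coordinates (r,s,t), phi restricted to the tangent space equals the volume
   form: phi(F_r,F_s,F_t) = |F_r /\ F_s /\ F_t|. *)
Definition ruled_associative (a b eps : R) (phi psi : R -> R -> Vec) : Prop :=
  forall r s t, dom a b eps s t ->
    let F := ruledF phi psi in
    let Fr : Vec := fun i => Derive (fun r' => F r' s t i) r in
    let Fs : Vec := fun i => Derive (fun s' => F r s' t i) s in
    let Ft : Vec := fun i => Derive (fun t' => F r s t' i) t in
    G2phi Fr Fs Ft = vol3 Fr Fs Ft.

Definition r_oriented_ruled_associative (a b eps : R) (phi psi : R -> R -> Vec) : Prop :=
  (forall s t, dom a b eps s t -> norm7 (phi s t) = 1) /\
  ruled_associative a b eps phi psi.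

(* Main.v *)
(** Expand a solution in powers of [t]: the equations force
    [X_{n+1} = (n+1)^{-1} sum_k phi_k x X_{n-k}'] for [X = phi] or [psi], so the Taylor
    coefficients in [t] are determined on [a,b] by the initial data. This gives uniqueness
    near [t = 0], hence everywhere by the identity theorem in [t]. It also defines the
    solution globally in [s] without patching, once convergence is known. For that
    (Cauchy-Kovalevskaya), if the initial data are majorised by [M / (1 - K x)] at a point
    [s], then [X_n(s + x)] is majorised by
    [M E^n (n+1)^{-2} (1 - K x)^{-(2n+1)}] with [E] proportional to [K M]: products add the
    exponents, a derivative costs [K (2n+1)], which the factor [(n+1)^{-1}] absorbs, and
    [1/(n+1)^2] is stable under convolution. By compactness [M] and [K] can be chosen
    uniformly on [a,b].

    Finally [d|phi|^2/dt = 2 phi . (phi x phi_s) = 0], and the tangent space of the ruled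
    3-fold is spanned by [phi], [w = r phi_s + psi_s] and [phi x w], on which the 3-form
    takes the value [|phi x w|^2], the volume of these three vectors. *)
Require Import Defs.
From Stdlib Require Import Reals Lra Lia ClassicalEpsilon.
From Coquelicot Require Import Coquelicot.
Open Scope R_scope.

(** * Double series *)

(** Both unknowns satisfy one equation, [X_t = phi x X_s], which is linear in [X] once [phi] is
    given; they are therefore treated as a family indexed by booleans.

    The obstacle is that every step of the recursion costs a derivative in [s]: plain Cauchy
    estimates would lose some radius each time. Letting the order of the pole of the majorant grow
    keeps the disc [|x| < 1 / K] for all [n]; the order rises by two per step, once for the product
    and once for the derivative. Only at the end is the pole order traded for a geometric bound
    [M K^m L^n] on the coefficients of the double series, from which termwise differentiation and
    analyticity follow by Fubini.

    Two points need extra care. Analyticity is claimed at all [(s, t)], so the series centred at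
    [(s, 0)] has to be re-expanded in [t]. And the data and equations are known on the closed
    interval only, while a derivative in [s] at an endpoint looks outside it; since the derivatives
    exist, difference quotients from inside determine them. *)

Lemma is_series_Series (a : nat -> R) (l : R) :
  is_series a l -> ex_series a /\ Series a = l.
Proof. intros H; split; [now exists l | now apply is_series_unique]. Qed.

Lemma ex_series_eq (a b : nat -> R) :
  (forall n, a n = b n) -> ex_series a -> ex_series b.
Proof. exact (ex_series_ext a b). Qed.

Lemma is_series_eq (a b : nat -> R) (l : R) :
  (forall n, a n = b n) -> is_series a l -> is_series b l.
Proof. exact (is_series_ext a b l). Qed.

Lemma ex_series_dominated (a b : nat -> R) :
  (forall n, Rabs (a n) <= b n) -> ex_series b -> ex_series a.
Proof. exact (@ex_series_le R_AbsRing R_CompleteNormedModule a b). Qed.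

Lemma ex_series_of_abs_le (a b : nat -> R) :
  (forall n, Rabs (a n) <= b n) -> ex_series b -> ex_series (fun n => Rabs (a n)).
Proof.
  intros H. apply ex_series_dominated. intros n. rewrite Rabs_Rabsolu. apply H.
Qed.

Lemma Series_abs_le (a b : nat -> R) :
  (forall n, Rabs (a n) <= b n) -> ex_series b -> Rabs (Series a) <= Series b.
Proof.
  intros H Hb.
  apply Rle_trans with (Series (fun n => Rabs (a n))).
  - apply Series_Rabs. now apply ex_series_of_abs_le with b.
  - apply Series_le; auto. intros n; split; [apply Rabs_pos | apply H].
Qed.

Lemma sum_le_Series (a : nat -> R) (N : nat) :
  (forall n, 0 <= a n) -> ex_series a -> sum_f_R0 a N <= Series a.
Proof.
  intros Ha Hex.
  rewrite (Series_incr_n a (S N)) by (auto; lia). simpl pred.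
  assert (0 <= Series (fun k => a (S N + k)%nat)); [|lra].
  (* Zero is written as the sum of a zero series, so that the tail can be compared with it term by
     term. *)
  rewrite <- (Rmult_0_l (Series (fun _ => 0))), <- Series_scal_l.
  apply Series_le.
  - intros n; rewrite Rmult_0_l; split; [lra | apply Ha].
  - now apply ex_series_incr_n.
Qed.

Lemma Series_nonneg (a : nat -> R) :
  (forall n, 0 <= a n) -> ex_series a -> 0 <= Series a.
Proof.
  intros Ha Hex. apply Rle_trans with (a 0%nat); [apply Ha|].
  exact (sum_le_Series a 0 Ha Hex).
Qed.

Lemma term_le_Series (a : nat -> R) (N : nat) :
  (forall n, 0 <= a n) -> ex_series a -> a N <= Series a.
Proof.
  intros Ha Hex. apply Rle_trans with (sum_f_R0 a N); [|now apply sum_le_Series].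
  destruct N as [|N]; simpl; [lra|].
  assert (0 <= sum_f_R0 a N) by (apply cond_pos_sum; auto). lra.
Qed.

Lemma Series_bounded (a : nat -> R) (M : R) :
  (forall n, 0 <= a n) -> (forall N, sum_f_R0 a N <= M) ->
  ex_series a /\ Series a <= M.
Proof.
  intros Ha HM.
  destruct (ex_finite_lim_seq_incr (sum_n a) M) as [l Hl].
  - intros n. rewrite sum_Sn. unfold plus; simpl. specialize (Ha (S n)). lra.
  - intros n. rewrite sum_n_Reals. apply HM.
  - assert (Hs : is_series a l) by exact Hl.
    destruct (is_series_Series _ _ Hs) as [H1 H2]. split; auto.
    rewrite H2.
    apply (is_lim_seq_le (sum_n a) (fun _ => M) l M); auto.
    + intros n. rewrite sum_n_Reals. apply HM.
    + apply is_lim_seq_const.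
Qed.

Lemma Series_sum (a : nat -> nat -> R) (M : nat) :
  (forall k, (k <= M)%nat -> ex_series (a k)) ->
  ex_series (fun n => sum_f_R0 (fun k => a k n) M) /\
  Series (fun n => sum_f_R0 (fun k => a k n) M) = sum_f_R0 (fun k => Series (a k)) M.
Proof.
  induction M as [|M IH]; intros H; simpl.
  - split; [apply H; lia | reflexivity].
  - destruct IH as [IH1 IH2]. { intros; apply H; lia. }
    assert (HS : ex_series (a (S M))) by (apply H; lia).
    split.
    + exact (ex_series_plus _ _ IH1 HS).
    + rewrite Series_plus by auto. now rewrite IH2.
Qed.

Definition abs_double (a : nat -> nat -> R) : Prop :=
  (forall n, ex_series (fun m => Rabs (a n m))) /\
  ex_series (fun n => Series (fun m => Rabs (a n m))).

(** [Series] is total, so the equality of the iterated sums is only useful together with convergence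
    of all rows, columns and iterated sums. Carrying them along makes the property stable under
    linear combinations. *)
Definition transposes (a : nat -> nat -> R) : Prop :=
  (forall n, ex_series (a n)) /\ ex_series (fun n => Series (a n)) /\
  (forall m, ex_series (fun n => a n m)) /\
  ex_series (fun m => Series (fun n => a n m)) /\
  Series (fun m => Series (fun n => a n m)) = Series (fun n => Series (a n)).

(** An entry is at most its row sum, so the columns converge. Finitely many columns can be summed
    inside the row sums, which bounds their total by the sum over rows. *)
Lemma tonelli_le (a : nat -> nat -> R) :
  (forall n m, 0 <= a n m) -> (forall n, ex_series (a n)) ->
  ex_series (fun n => Series (a n)) ->
  (forall m, ex_series (fun n => a n m)) /\
  ex_series (fun m => Series (fun n => a n m)) /\
  Series (fun m => Series (fun n => a n m)) <= Series (fun n => Series (a n)).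
Proof.
  intros Ha H1 H2.
  assert (Hc : forall m, ex_series (fun n => a n m)).
  { intros m. apply ex_series_dominated with (fun n => Series (a n)); auto.
    intros n. rewrite Rabs_pos_eq by apply Ha. now apply term_le_Series. }
  split; auto.
  apply Series_bounded.
  - intros m. apply Series_nonneg; auto.
  - intros N. rewrite <- (proj2 (Series_sum (fun k n => a n k) N (fun k _ => Hc k))).
    apply Series_le; auto. intros n. split.
    + apply cond_pos_sum; auto.
    + now apply (sum_le_Series (a n)).
Qed.

(** The inequality for [a] and for its transpose together give equality. *)
Lemma tonelli (a : nat -> nat -> R) :
  (forall n m, 0 <= a n m) -> (forall n, ex_series (a n)) ->
  ex_series (fun n => Series (a n)) -> transposes a.
Proof.
  intros Ha H1 H2.
  destruct (tonelli_le a Ha H1 H2) as (H3 & H4 & H5).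
  destruct (tonelli_le (fun m n => a n m)) as (_ & _ & H6); auto.
  unfold transposes. repeat split; auto. now apply Rle_antisym.
Qed.

Lemma transposes_lin (a b : nat -> nat -> R) (x y : R) :
  transposes a -> transposes b -> transposes (fun n m => x * a n m + y * b n m).
Proof.
  assert (Hl : forall u v : nat -> R, ex_series u -> ex_series v ->
     ex_series (fun n => x * u n + y * v n) /\
     Series (fun n => x * u n + y * v n) = x * Series u + y * Series v).
  { intros u v Hu Hv.
    assert (Hu' := ex_series_scal x u Hu). assert (Hv' := ex_series_scal y v Hv).
    split.
    - exact (ex_series_plus _ _ Hu' Hv').
    - rewrite Series_plus by assumption. now rewrite !Series_scal_l. }
  intros (A1 & A2 & A3 & A4 & A5) (B1 & B2 & B3 & B4 & B5).
  assert (Er : forall n, Series (fun m => x * a n m + y * b n m)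
                         = x * Series (a n) + y * Series (b n)).
  { intros n; now apply Hl. }
  assert (Ec : forall m, Series (fun n => x * a n m + y * b n m)
     = x * Series (fun n => a n m) + y * Series (fun n => b n m)).
  { intros m; now apply Hl. }
  repeat split.
  - intros n; now apply Hl.
  - apply ex_series_eq with (fun n => x * Series (a n) + y * Series (b n)).
    + intros n; now rewrite Er.
    + now apply Hl.
  - intros m; now apply Hl.
  - apply ex_series_eq with
      (fun m => x * Series (fun n => a n m) + y * Series (fun n => b n m)).
    + intros n; now rewrite Ec.
    + now apply Hl.
  - rewrite (Series_ext _ _ Er), (Series_ext _ _ Ec).
    rewrite (proj2 (Hl _ _ A2 B2)), (proj2 (Hl _ _ A4 B4)). now rewrite A5, B5.
Qed.

(** Decompose [a = (|a| + a) - |a|] into two nonnegative arrays and use linearity. *)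
Lemma fubini (a : nat -> nat -> R) : abs_double a -> transposes a.
Proof.
  intros [H1 H2].
  assert (Habs : transposes (fun n m => Rabs (a n m))).
  { apply tonelli; auto. intros; apply Rabs_pos. }
  assert (Hpos : transposes (fun n m => Rabs (a n m) + a n m)).
  { assert (Hs : forall n, ex_series (fun m => Rabs (a n m) + a n m)).
    { intros n. apply (ex_series_plus (fun m => Rabs (a n m)) (a n)); auto.
      now apply ex_series_Rabs. }
    apply tonelli; auto.
    - intros n m. generalize (Rle_abs (- a n m)). rewrite Rabs_Ropp. lra.
    - apply ex_series_dominated with (fun n => 2 * Series (fun m => Rabs (a n m))).
      + intros n. rewrite <- Series_scal_l. apply Series_abs_le.
        * intros m. apply Rle_trans with (1 := Rabs_triang _ _).
          rewrite Rabs_Rabsolu. lra.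
        * exact (ex_series_scal 2 _ (H1 n)).
      + exact (ex_series_scal 2 _ H2). }
  generalize (transposes_lin _ _ 1 (-1) Hpos Habs).
  assert (E : forall n m, 1 * (Rabs (a n m) + a n m) + -1 * Rabs (a n m) = a n m)
    by (intros; ring).
  intros (A1 & A2 & A3 & A4 & A5).
  assert (Er : forall n, Series (fun m => 1 * (Rabs (a n m) + a n m) + -1 * Rabs (a n m))
     = Series (a n)) by (intros n; apply Series_ext; auto).
  assert (Ec : forall m, Series (fun n => 1 * (Rabs (a n m) + a n m) + -1 * Rabs (a n m))
     = Series (fun n => a n m)) by (intros m; apply Series_ext; auto).
  repeat split.
  - intros n. now apply ex_series_eq with (2 := A1 n).
  - now apply ex_series_eq with (2 := A2).
  - intros m. apply ex_series_eq with (2 := A3 m). auto.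
  - now apply ex_series_eq with (2 := A4).
  - rewrite <- (Series_ext _ _ Er), <- (Series_ext _ _ Ec). exact A5.
Qed.

Lemma abs_double_le (a b : nat -> nat -> R) :
  (forall n m, Rabs (a n m) <= b n m) -> (forall n, ex_series (b n)) ->
  ex_series (fun n => Series (b n)) -> abs_double a.
Proof.
  intros H H1 H2. split.
  - intros n. now apply ex_series_of_abs_le with (b n).
  - apply ex_series_dominated with (2 := H2). intros n.
    apply Series_abs_le; auto. intros m. rewrite Rabs_Rabsolu. auto.
Qed.

Lemma abs_double_prod (a : nat -> nat -> R) (u v : nat -> R) :
  (forall n m, Rabs (a n m) <= u n * v m) -> ex_series u -> ex_series v ->
  abs_double a.
Proof.
  intros H Hu Hv. apply abs_double_le with (1 := H).
  - intros n. exact (ex_series_scal (u n) v Hv).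
  - apply ex_series_eq with (fun n => u n * Series v).
    + intros n. now rewrite Series_scal_l.
    + now apply ex_series_scal_r.
Qed.

(** * Re-expansion of power series *)

Lemma ex_series_geom_scal (M q : R) : 0 <= q < 1 -> ex_series (fun n => M * q ^ n).
Proof.
  intros Hq. apply (ex_series_scal M (fun n => q ^ n)).
  apply ex_series_geom. rewrite Rabs_pos_eq; lra.
Qed.

Lemma Series_geom_scal (M q : R) : 0 <= q < 1 -> Series (fun n => M * q ^ n) = M / (1 - q).
Proof.
  intros Hq. rewrite Series_scal_l, Series_geom; auto. rewrite Rabs_pos_eq; lra.
Qed.

Definition geo_bound (M K : R) (p : nat -> R) : Prop := forall m, Rabs (p m) <= M * K ^ m.

Lemma geo_bound_term (M K x : R) (p : nat -> R) (m : nat) :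
  geo_bound M K p -> Rabs (p m * x ^ m) <= M * (K * Rabs x) ^ m.
Proof.
  intros H. rewrite Rabs_mult, <- RPow_abs, Rpow_mult_distr, <- Rmult_assoc.
  apply Rmult_le_compat_r; auto. apply pow_le, Rabs_pos.
Qed.

Lemma geo_bound_nonneg (M K : R) (p : nat -> R) : geo_bound M K p -> 0 <= M.
Proof. intros H. specialize (H 0%nat). simpl in H. generalize (Rabs_pos (p 0%nat)). lra. Qed.

Lemma geo_bound_Series (M K x : R) (p : nat -> R) :
  0 <= K -> geo_bound M K p -> K * Rabs x < 1 ->
  ex_series (fun m => Rabs (p m * x ^ m)) /\ ex_series (fun m => p m * x ^ m) /\
  Rabs (Series (fun m => p m * x ^ m)) <= M / (1 - K * Rabs x).
Proof.
  intros HK H Hx.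
  assert (Hq : 0 <= K * Rabs x < 1).
  { split; auto. apply Rmult_le_pos; auto. apply Rabs_pos. }
  assert (Hex := ex_series_geom_scal M _ Hq).
  assert (Hle := fun m => geo_bound_term M K x p m H).
  repeat split.
  - now apply ex_series_of_abs_le with (1 := Hle).
  - now apply ex_series_dominated with (1 := Hle).
  - rewrite <- Series_geom_scal by auto. now apply Series_abs_le.
Qed.

(** Strictness comes from the midpoint of [|x|] and [rho]: if the radius were below it, the terms
    there could not tend to 0. *)
Lemma CV_radius_gt (p : nat -> R) (rho x : R) :
  (forall y, Rabs y < rho -> ex_series (fun m => p m * y ^ m)) ->
  Rabs x < rho -> Rbar_lt (Rabs x) (CV_radius p).
Proof.
  intros H Hx.
  apply Rbar_lt_le_trans with ((Rabs x + rho) / 2).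
  - simpl. lra.
  - apply Rbar_not_lt_le. intros Hlt.
    assert (Ha : Rabs ((Rabs x + rho) / 2) = (Rabs x + rho) / 2).
    { apply Rabs_pos_eq. generalize (Rabs_pos x). lra. }
    apply (CV_disk_outside p ((Rabs x + rho) / 2)).
    + now rewrite Ha.
    + apply ex_series_lim_0, H. rewrite Ha. lra.
Qed.

Lemma is_series_finite_support (a : nat -> R) (N : nat) :
  (forall n, (N < n)%nat -> a n = 0) -> is_series a (sum_f_R0 a N).
Proof.
  intros H.
  assert (Hz : ex_series (fun k => a (S N + k)%nat)).
  { apply ex_series_eq with (fun n => 0 * 0 ^ n).
    - intros n. rewrite H by lia. ring.
    - apply ex_series_geom_scal. lra. }
  assert (Hex : ex_series a) by now apply (ex_series_incr_n a (S N)).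
  replace (sum_f_R0 a N) with (Series a); [now apply Series_correct|].
  rewrite (Series_incr_n a (S N)) by (auto; lia). simpl pred.
  rewrite (Series_ext _ (fun k => 0 * a k)).
  - rewrite Series_scal_l. ring.
  - intros n. rewrite H by lia. ring.
Qed.

(* Zero for [m < j], where Stdlib's [Binomial.C m j] is not. *)
Definition binc (m j : nat) : R := if (j <=? m)%nat then Binomial.C m j else 0.

Lemma binc_nonneg (m j : nat) : 0 <= binc m j.
Proof.
  unfold binc. destruct (j <=? m)%nat; [|lra].
  unfold Binomial.C. apply Rlt_le, Rdiv_lt_0_compat.
  - apply INR_fact_lt_0.
  - apply Rmult_lt_0_compat; apply INR_fact_lt_0.
Qed.

Lemma is_series_binomial (x y : R) (m : nat) :
  is_series (fun j => binc m j * x ^ (m - j) * y ^ j) ((x + y) ^ m).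
Proof.
  replace ((x + y) ^ m) with (sum_f_R0 (fun j => binc m j * x ^ (m - j) * y ^ j) m).
  - apply is_series_finite_support. intros j Hj. unfold binc.
    rewrite (proj2 (Nat.leb_gt j m)) by lia. ring.
  - rewrite Rplus_comm, binomial. apply sum_eq. intros j Hj. unfold binc.
    rewrite (proj2 (Nat.leb_le j m)) by lia. ring.
Qed.

(** The coefficient of [tau^j] after expanding each [(x0 + tau)^m] by the binomial theorem. *)
Definition recenter (p : nat -> R) (x0 : R) (j : nat) : R :=
  Series (fun m => p m * (binc m j * x0 ^ (m - j))).

Section Recentering.
Variables (M K x0 r : R).
Hypotheses (HM : 0 <= M) (HK : 0 <= K) (Hr : 0 < r) (Hx0 : K * (Rabs x0 + r) < 1).

(** The one array that dominates everything below: summed over [j] first, it becomes a geometric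
    series of ratio [K (|x0| + r)]. *)
Let B (m j : nat) := M * K ^ m * (binc m j * Rabs x0 ^ (m - j)) * r ^ j.

Local Lemma B_row (m : nat) : is_series (B m) (M * (K * (Rabs x0 + r)) ^ m).
Proof.
  rewrite Rpow_mult_distr, <- Rmult_assoc.
  apply (is_series_eq (fun j => M * K ^ m * (binc m j * Rabs x0 ^ (m - j) * r ^ j))).
  - intros j. unfold B. ring.
  - apply (is_series_scal (M * K ^ m) _ _ (is_series_binomial (Rabs x0) r m)).
Qed.

Local Lemma B_nonneg (m j : nat) : 0 <= B m j.
Proof.
  unfold B. repeat apply Rmult_le_pos; auto using pow_le, binc_nonneg, Rlt_le, Rabs_pos.
Qed.

Local Lemma ratio : 0 <= K * (Rabs x0 + r) < 1.
Proof. split; auto. apply Rmult_le_pos; auto. generalize (Rabs_pos x0). lra. Qed.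

Local Lemma B_total :
  ex_series (fun m => Series (B m)) /\
  Series (fun m => Series (B m)) = M / (1 - K * (Rabs x0 + r)).
Proof.
  assert (E : forall m, M * (K * (Rabs x0 + r)) ^ m = Series (B m)).
  { intros m. symmetry. apply is_series_unique, B_row. }
  split.
  - apply ex_series_eq with (1 := E), ex_series_geom_scal, ratio.
  - rewrite <- (Series_ext _ _ E). apply Series_geom_scal, ratio.
Qed.

Local Lemma B_transposes : transposes B.
Proof.
  apply tonelli; [exact B_nonneg | | apply B_total].
  intros n. eexists. apply B_row.
Qed.

(** A column sum of [B] is at most the sum of all entries; dividing by [r^j] yields an estimate of
    Cauchy type. *)
Lemma recenter_dominant (j : nat) :
  ex_series (fun m => M * K ^ m * (binc m j * Rabs x0 ^ (m - j))) /\
  Series (fun m => M * K ^ m * (binc m j * Rabs x0 ^ (m - j)))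
    <= M / (1 - K * (Rabs x0 + r)) * (/ r) ^ j.
Proof.
  destruct B_transposes as (_ & _ & H3 & H4 & H5).
  assert (Hrj : 0 < r ^ j) by now apply pow_lt.
  assert (E : forall m, / r ^ j * B m j
                        = M * K ^ m * (binc m j * Rabs x0 ^ (m - j))).
  { intros m. unfold B. field. lra. }
  split.
  - apply ex_series_eq with (1 := E). exact (ex_series_scal (/ r ^ j) _ (H3 j)).
  - rewrite <- (Series_ext _ _ E), Series_scal_l, pow_inv, Rmult_comm.
    apply Rmult_le_compat_r; [now apply Rlt_le, Rinv_0_lt_compat|].
    rewrite <- (proj2 B_total), <- H5.
    apply (term_le_Series (fun j => Series (fun n => B n j)) j); auto.
    intros i. apply Series_nonneg; auto. intros n. apply B_nonneg.
Qed.

Variable p : nat -> R.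
Hypothesis Hp : geo_bound M K p.

Local Lemma recenter_term (m j : nat) :
  Rabs (p m * (binc m j * x0 ^ (m - j)))
    <= M * K ^ m * (binc m j * Rabs x0 ^ (m - j)).
Proof.
  rewrite !Rabs_mult, <- RPow_abs, (Rabs_pos_eq (binc m j)) by apply binc_nonneg.
  apply Rmult_le_compat_r; auto.
  apply Rmult_le_pos; [apply binc_nonneg | apply pow_le, Rabs_pos].
Qed.

Lemma recenter_geo_bound : geo_bound (M / (1 - K * (Rabs x0 + r))) (/ r) (recenter p x0).
Proof.
  intros j. destruct (recenter_dominant j) as [H1 H2].
  apply Rle_trans with (2 := H2). apply Series_abs_le; auto.
  intros m. apply recenter_term.
Qed.

Lemma recenter_is_series (tau : R) :
  Rabs tau <= r ->
  is_series (fun j => recenter p x0 j * tau ^ j) (Series (fun m => p m * (x0 + tau) ^ m)).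
Proof.
  intros Htau.
  destruct (fubini (fun m j => p m * (binc m j * x0 ^ (m - j)) * tau ^ j))
    as (H1 & H2 & H3 & H4 & H5).
  - apply abs_double_le with B.
    + intros m j. unfold B. rewrite Rabs_mult, <- RPow_abs.
      apply Rmult_le_compat; try apply Rabs_pos.
      * apply pow_le, Rabs_pos.
      * apply recenter_term.
      * apply pow_incr. split; auto. apply Rabs_pos.
    + intros m. eexists; apply B_row.
    + apply B_total.
  - assert (E : forall j, Series (fun m => p m * (binc m j * x0 ^ (m - j)) * tau ^ j)
                     = recenter p x0 j * tau ^ j).
    { intros j. apply Series_scal_r. }
    replace (Series (fun m => p m * (x0 + tau) ^ m))
      with (Series (fun j => recenter p x0 j * tau ^ j)).
    + apply Series_correct. now apply ex_series_eq with (1 := E).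
    + rewrite <- (Series_ext _ _ E), H5. apply Series_ext. intros m.
      apply is_series_unique.
      apply (is_series_eq (fun j => p m * (binc m j * x0 ^ (m - j) * tau ^ j))).
      * intros j. now rewrite !Rmult_assoc.
      * apply (is_series_scal (p m) _ _ (is_series_binomial x0 tau m)).
Qed.

End Recentering.

Lemma analytic2_at_of_geo_bound (f : R -> R -> R) (c : nat -> nat -> R) (M K L x0 y0 rho : R) :
  0 <= K -> 0 <= L -> (forall m n, Rabs (c m n) <= M * K ^ m * L ^ n) ->
  0 < rho -> K * rho <= 1 -> L * rho <= 1 ->
  (forall x y, Rabs (x - x0) < rho -> Rabs (y - y0) < rho ->
     f x y = Series (fun n => Series (fun m => c m n * (x - x0) ^ m * (y - y0) ^ n))) ->
  analytic2_at f x0 y0.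
Proof.
  intros HK HL Hc Hrho HKr HLr Hf. exists c, rho. split; auto.
  assert (Hq : forall N z, 0 <= N -> N * rho <= 1 -> Rabs z < rho -> 0 <= N * Rabs z < 1).
  { intros N z HN HNr Hz. assert (Hp := Rabs_pos z). split.
    - apply Rmult_le_pos; auto.
    - destruct HN as [HN|HN]; [|subst N; lra].
      apply Rlt_le_trans with (2 := HNr). now apply Rmult_lt_compat_l. }
  intros x y Hx Hy. split; [|split]; [| |auto].
  1,2: destruct (abs_double_prod (fun n m => Rabs (c m n) * Rabs (x - x0) ^ m * Rabs (y - y0) ^ n)
    (fun n => M * (L * Rabs (y - y0)) ^ n) (fun m => 1 * (K * Rabs (x - x0)) ^ m)) as [H1 H2];
    [ intros n m; rewrite !Rabs_mult, Rabs_Rabsolu, <- !RPow_abs, !Rabs_Rabsolu;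
      rewrite !Rpow_mult_distr;
      replace (M * (L ^ n * Rabs (y - y0) ^ n) * (1 * (K ^ m * Rabs (x - x0) ^ m)))
        with (M * K ^ m * L ^ n * Rabs (x - x0) ^ m * Rabs (y - y0) ^ n) by ring;
      repeat apply Rmult_le_compat_r; auto using pow_le, Rabs_pos
    | apply ex_series_geom_scal; auto | apply ex_series_geom_scal; auto | ].
  all: assert (E : forall n m, Rabs (Rabs (c m n) * Rabs (x - x0) ^ m * Rabs (y - y0) ^ n)
      = Rabs (c m n) * Rabs (x - x0) ^ m * Rabs (y - y0) ^ n)
    by (intros n m; apply Rabs_pos_eq; repeat apply Rmult_le_pos; auto using pow_le, Rabs_pos).
  - intros n. apply ex_series_eq with (2 := H1 n). auto.
  - apply ex_series_eq with (2 := H2). intros n. apply Series_ext. auto.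
Qed.

(** Moves the centre in the second variable only. The rows [c m] are recentred one by one, and their
    bounds keep the factor [K^m], so the new array is again geometric in both indices. *)
Lemma recenter2 (c : nat -> nat -> R) (M K L y0 r : R) :
  0 <= M -> 0 <= K -> 0 <= L -> (forall m n, Rabs (c m n) <= M * K ^ m * L ^ n) ->
  0 < r -> L * (Rabs y0 + r) < 1 ->
  (forall m j, Rabs (recenter (c m) y0 j)
     <= M / (1 - L * (Rabs y0 + r)) * K ^ m * (/ r) ^ j) /\
  (forall x tau, K * Rabs x < 1 -> Rabs tau <= r ->
     Series (fun n => Series (fun m => c m n * x ^ m) * (y0 + tau) ^ n)
     = Series (fun j => Series (fun m => recenter (c m) y0 j * x ^ m * tau ^ j))).
Proof.
  intros HM HK HL Hc Hr Hy0.
  assert (Hcm : forall m, geo_bound (M * K ^ m) L (c m)) by (intros m n; apply Hc).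
  assert (Hcn : forall n, geo_bound (M * L ^ n) K (fun m => c m n)).
  { intros n m. apply Rle_trans with (1 := Hc m n). apply Req_le; ring. }
  split.
  - intros m j.
    assert (H := recenter_geo_bound (M * K ^ m) L y0 r
      (Rmult_le_pos _ _ HM (pow_le _ m HK)) HL Hr Hy0 (c m) (Hcm m) j).
    apply Rle_trans with (1 := H). apply Req_le. unfold Rdiv. ring.
  - intros x tau Hx Htau.
    assert (Hq : 0 <= K * Rabs x < 1).
    { split; auto. apply Rmult_le_pos; auto. apply Rabs_pos. }
    (* For fixed [x], [g n] is the coefficient of [y^n]. Recentring [g] and then exchanging the sums
       over [n] and [m] produces the recentred rows. *)
    set (g := fun n => Series (fun m => c m n * x ^ m)).
    assert (Hg : geo_bound (M / (1 - K * Rabs x)) L g).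
    { intros n. destruct (geo_bound_Series _ _ x _ HK (Hcn n) Hx) as (_ & _ & H).
      apply Rle_trans with (1 := H). apply Req_le. unfold Rdiv. ring. }
    assert (HMg : 0 <= M / (1 - K * Rabs x)) by now apply geo_bound_nonneg in Hg.
    change (Series (fun n => g n * (y0 + tau) ^ n)
      = Series (fun j => Series (fun m => recenter (c m) y0 j * x ^ m * tau ^ j))).
    rewrite <- (is_series_unique _ _
      (recenter_is_series _ _ _ _ HL Hr Hy0 g Hg tau Htau)).
    apply Series_ext. intros j. rewrite Series_scal_r. f_equal.
    destruct (recenter_dominant M L y0 r HM HL Hr Hy0 j) as [Hd _].
    destruct (fubini (fun n m => c m n * x ^ m * (binc n j * y0 ^ (n - j))))
      as (_ & _ & _ & _ & H5).
    + apply abs_double_prod with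
        (u := fun n => M * L ^ n * (binc n j * Rabs y0 ^ (n - j)))
        (v := fun m => 1 * (K * Rabs x) ^ m).
      * intros n m. rewrite !Rabs_mult, <- !RPow_abs, Rpow_mult_distr.
        rewrite (Rabs_pos_eq (binc n j)) by apply binc_nonneg.
        replace (M * L ^ n * (binc n j * Rabs y0 ^ (n - j)) * (1 * (K ^ m * Rabs x ^ m)))
          with (M * K ^ m * L ^ n * Rabs x ^ m * (binc n j * Rabs y0 ^ (n - j))) by ring.
        repeat apply Rmult_le_compat_r; auto using pow_le, Rabs_pos.
        apply Rmult_le_pos; auto using pow_le, Rabs_pos, binc_nonneg.
      * exact Hd.
      * now apply ex_series_geom_scal.
    + unfold recenter at 1, g.
      transitivity (Series (fun n => Series (fun m => c m n * x ^ m * (binc n j * y0 ^ (n - j))))).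
      { apply Series_ext. intros n. now rewrite Series_scal_r. }
      rewrite <- H5. apply Series_ext. intros m.
      unfold recenter. rewrite <- Series_scal_r. apply Series_ext. intros n. ring.
Qed.

(** * Double power series as power series in the second variable *)

Definition pow_sum (c : nat -> R) (f : R -> R) (rho : R) : Prop :=
  forall x, Rabs x < rho -> is_series (fun n => c n * x ^ n) (f x).

Lemma pow_sum_PSeries (c : nat -> R) (f : R -> R) (rho x : R) :
  pow_sum c f rho -> Rabs x < rho -> f x = PSeries c x.
Proof. intros H Hx. symmetry. apply (is_pseries_unique c x), is_pseries_R, H, Hx. Qed.

Lemma pow_sum_radius (c : nat -> R) (f : R -> R) (rho x : R) :
  pow_sum c f rho -> Rabs x < rho -> Rbar_lt (Rabs x) (CV_radius c).
Proof. intros H. apply CV_radius_gt. intros y Hy. eexists. apply H, Hy. Qed.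

Lemma pow_sum_of_radius (c : nat -> R) (rho : R) :
  (forall x, Rabs x < rho -> ex_series (fun n => c n * x ^ n)) ->
  pow_sum c (PSeries c) rho.
Proof. intros H x Hx. apply (is_pseries_R c x), PSeries_correct, ex_pseries_R, H, Hx. Qed.

Lemma pow_sum_ext (c d : nat -> R) (f g : R -> R) (rho : R) :
  (forall n, c n = d n) -> (forall x, Rabs x < rho -> f x = g x) ->
  pow_sum c f rho -> pow_sum d g rho.
Proof.
  intros E E' H x Hx. rewrite <- E' by auto.
  apply is_series_eq with (2 := H x Hx). intros n. now rewrite E.
Qed.

Lemma pow_sum_le (c : nat -> R) (f : R -> R) (rho rho' : R) :
  rho' <= rho -> pow_sum c f rho -> pow_sum c f rho'.
Proof. intros Hle H x Hx. apply H. lra. Qed.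

Lemma pow_sum_plus (c d : nat -> R) (f g : R -> R) (rho : R) :
  pow_sum c f rho -> pow_sum d g rho ->
  pow_sum (fun n => c n + d n) (fun x => f x + g x) rho.
Proof.
  intros Hf Hg x Hx.
  apply (is_series_eq (fun n => c n * x ^ n + d n * x ^ n)); [intros; ring|].
  exact (is_series_plus _ _ _ _ (Hf x Hx) (Hg x Hx)).
Qed.

Lemma pow_sum_scal (k : R) (c : nat -> R) (f : R -> R) (rho : R) :
  pow_sum c f rho -> pow_sum (fun n => k * c n) (fun x => k * f x) rho.
Proof.
  intros Hf x Hx.
  apply (is_series_eq (fun n => k * (c n * x ^ n))); [intros; ring|].
  exact (is_series_scal k _ _ (Hf x Hx)).
Qed.

Lemma pow_sum_sum (c : nat -> nat -> R) (f : nat -> R -> R) (rho : R) (N : nat) :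
  (forall i, (i <= N)%nat -> pow_sum (c i) (f i) rho) ->
  pow_sum (fun n => sum_f_R0 (fun i => c i n) N) (fun x => sum_f_R0 (fun i => f i x) N) rho.
Proof.
  induction N as [|N IH]; intros H; simpl.
  - now apply (H 0%nat).
  - apply pow_sum_plus; [apply IH; intros; apply H; lia | apply H; lia].
Qed.

Lemma pow_sum_mult (c d : nat -> R) (f g : R -> R) (rho : R) :
  pow_sum c f rho -> pow_sum d g rho ->
  pow_sum (PS_mult c d) (fun x => f x * g x) rho.
Proof.
  intros Hf Hg x Hx. apply (is_pseries_R (PS_mult c d) x).
  apply is_pseries_mult.
  - now apply is_pseries_R, Hf.
  - now apply is_pseries_R, Hg.
  - now apply pow_sum_radius with (1 := Hf).
  - now apply pow_sum_radius with (1 := Hg).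
Qed.

Lemma locally_Rabs_lt (x rho : R) : Rabs x < rho -> locally x (fun y => Rabs y < rho).
Proof.
  intros Hx. assert (Hd : 0 < rho - Rabs x) by lra.
  exists (mkposreal _ Hd). intros y Hy.
  assert (Hy' : Rabs (y - x) < rho - Rabs x) by exact Hy.
  generalize (Rabs_triang (y - x) x).
  unfold Rminus at 1. rewrite Rplus_assoc, Rplus_opp_l, Rplus_0_r. lra.
Qed.

Lemma pow_sum_is_derive (c : nat -> R) (f : R -> R) (rho x : R) :
  pow_sum c f rho -> Rabs x < rho -> is_derive f x (PSeries (PS_derive c) x).
Proof.
  intros H Hx. apply is_derive_ext_loc with (PSeries c).
  - apply filter_imp with (2 := locally_Rabs_lt x rho Hx).
    intros y Hy. symmetry. now apply pow_sum_PSeries with rho.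
  - now apply is_derive_PSeries, pow_sum_radius with (1 := H).
Qed.

Lemma pow_sum_derive (c : nat -> R) (f : R -> R) (rho : R) :
  pow_sum c f rho -> pow_sum (PS_derive c) (Derive f) rho.
Proof.
  intros H x Hx. apply (is_pseries_R (PS_derive c) x).
  rewrite (is_derive_unique _ _ _ (pow_sum_is_derive _ _ _ _ H Hx)).
  apply PSeries_correct, ex_pseries_derive. now apply pow_sum_radius with (1 := H).
Qed.

Lemma pow_sum_unique (c d : nat -> R) (f : R -> R) (rho : R) :
  0 < rho -> pow_sum c f rho -> pow_sum d f rho -> forall n, c n = d n.
Proof.
  intros Hrho Hc Hd n.
  assert (H0 : Rabs 0 < rho) by now rewrite Rabs_R0.
  apply PSeries_ext_recip.
  - rewrite <- Rabs_R0. now apply pow_sum_radius with (1 := Hc).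
  - rewrite <- Rabs_R0. now apply pow_sum_radius with (1 := Hd).
  - apply filter_imp with (2 := locally_Rabs_lt 0 rho H0). intros x Hx.
    rewrite <- (pow_sum_PSeries _ _ _ _ Hc Hx). now apply pow_sum_PSeries with (1 := Hd).
Qed.

Lemma pow_sum_0 (c : nat -> R) (f : R -> R) (rho : R) :
  0 < rho -> pow_sum c f rho -> f 0 = c 0%nat.
Proof.
  intros Hrho H. rewrite (pow_sum_PSeries _ _ _ 0 H) by now rewrite Rabs_R0.
  apply PSeries_0.
Qed.

Lemma is_derive_shift (f : R -> R) (x0 x l : R) :
  is_derive (fun y => f (x0 + y)) x l -> is_derive f (x0 + x) l.
Proof.
  intros H.
  apply (is_derive_ext (fun z => f (x0 + (z - x0)))).
  { intros z. f_equal. ring. }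
  replace l with (scal 1 l) by (unfold scal; simpl; unfold mult; simpl; ring).
  apply (is_derive_comp (fun y => f (x0 + y)) (fun z => z - x0)).
  - now replace (x0 + x - x0) with x by ring.
  - auto_derive; auto.
Qed.

Definition expands (f : R -> R -> R) (s0 y0 : R) (c : nat -> nat -> R) (rho : R) : Prop :=
  forall x y, Rabs x < rho -> Rabs y < rho ->
    abs_double (fun n m => c m n * x ^ m * y ^ n) /\
    f (s0 + x) (y0 + y) = Series (fun n => Series (fun m => c m n * x ^ m * y ^ n)).

Lemma analytic2_expands (f : R -> R -> R) (s0 y0 : R) :
  analytic2_at f s0 y0 -> exists c rho, 0 < rho /\ expands f s0 y0 c rho.
Proof.
  intros (c & rho & Hrho & H). exists c, rho. split; auto. intros x y Hx Hy.
  assert (Ex : s0 + x - s0 = x) by ring. assert (Ey : y0 + y - y0 = y) by ring.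
  destruct (H (s0 + x) (y0 + y)) as (H1 & H2 & H3); rewrite ?Ex, ?Ey; auto.
  rewrite Ex, Ey in *. split; [|exact H3].
  assert (E : forall n m, Rabs (c m n) * Rabs x ^ m * Rabs y ^ n
                          = Rabs (c m n * x ^ m * y ^ n)).
  { intros n m. now rewrite !Rabs_mult, <- !RPow_abs. }
  split.
  - intros n. apply ex_series_eq with (2 := H1 n). auto.
  - apply ex_series_eq with (2 := H2). intros n. apply Series_ext. auto.
Qed.

Section Expansion.
Variables (f : R -> R -> R) (s0 y0 : R) (c : nat -> nat -> R) (rho : R).
Hypotheses (Hrho : 0 < rho) (Hf : expands f s0 y0 c rho).

Local Lemma half_lt : Rabs (rho / 2) < rho.
Proof. rewrite Rabs_pos_eq; lra. Qed.

(** A single row is isolated from the double series at the nonzero point [x = rho / 2], by dividing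
    by [(rho / 2)^m]. Columns are treated in the same way. *)
Lemma expands_row (m : nat) : pow_sum (c m) (PSeries (c m)) rho.
Proof.
  apply pow_sum_of_radius. intros y Hy.
  destruct (fubini _ (proj1 (Hf _ _ half_lt Hy))) as (_ & _ & H & _).
  apply (ex_series_eq (fun n => / (rho / 2) ^ m * (c m n * (rho / 2) ^ m * y ^ n))).
  - intros n. field. apply pow_nonzero. lra.
  - exact (ex_series_scal _ _ (H m)).
Qed.

Lemma expands_col (n : nat) : pow_sum (fun m => c m n) (PSeries (fun m => c m n)) rho.
Proof.
  apply pow_sum_of_radius. intros x Hx.
  destruct (fubini _ (proj1 (Hf _ _ Hx half_lt))) as (H & _).
  apply (ex_series_eq (fun m => / (rho / 2) ^ n * (c m n * x ^ m * (rho / 2) ^ n))).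
  - intros m. field. apply pow_nonzero. lra.
  - exact (ex_series_scal _ _ (H n)).
Qed.

Lemma expands_slice (x : R) :
  Rabs x < rho ->
  pow_sum (fun n => PSeries (fun m => c m n) x) (fun y => f (s0 + x) (y0 + y)) rho.
Proof.
  intros Hx y Hy.
  destruct (Hf x y Hx Hy) as [H1 H2]. destruct (fubini _ H1) as (_ & H & _).
  rewrite H2.
  apply is_series_eq with (fun n => Series (fun m => c m n * x ^ m * y ^ n)).
  - intros n. apply Series_scal_r.
  - now apply Series_correct.
Qed.

Lemma expands_center : pow_sum (c 0%nat) (fun y => f s0 (y0 + y)) rho.
Proof.
  apply pow_sum_ext with (3 := expands_slice 0 ltac:(now rewrite Rabs_R0)).
  - intros n. apply PSeries_0.
  - intros y _. now rewrite Rplus_0_r.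
Qed.

(** Grouped by powers of [x], the double series is a power series in [x] whose linear coefficient is
    the row [c 1] summed in [y]. *)
Lemma expands_is_derive (y : R) :
  Rabs y < rho -> is_derive (fun s => f s (y0 + y)) s0 (PSeries (c 1%nat) y).
Proof.
  intros Hy.
  assert (H : pow_sum (fun m => PSeries (c m) y) (fun x => f (s0 + x) (y0 + y)) rho).
  { intros x Hx. destruct (Hf x y Hx Hy) as [H1 H2].
    destruct (fubini _ H1) as (_ & _ & _ & H & E).
    rewrite H2, <- E.
    apply is_series_eq with (fun m => Series (fun n => c m n * x ^ m * y ^ n)).
    - intros m. unfold PSeries. rewrite <- Series_scal_r. apply Series_ext. intros n. ring.
    - now apply Series_correct. }
  replace s0 with (s0 + 0) by ring. apply is_derive_shift.
  replace (PSeries (c 1%nat) y) with (PSeries (PS_derive (fun m => PSeries (c m) y)) 0).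
  - apply pow_sum_is_derive with (1 := H). now rewrite Rabs_R0.
  - rewrite PSeries_0. unfold PS_derive. simpl. ring.
Qed.

End Expansion.

(** Defined by derivatives and not by a chosen expansion, so that it is one function of [s] which
    can itself be differentiated. *)
Definition tcoef (f : R -> R -> R) (n : nat) (s : R) : R :=
  Derive_n (f s) n 0 / INR (Factorial.fact n).

Lemma pow_sum_Derive_n (c : nat -> R) (f : R -> R) (rho : R) (n : nat) :
  0 < rho -> pow_sum c f rho -> Derive_n f n 0 / INR (Factorial.fact n) = c n.
Proof.
  intros Hrho H. assert (H0 : Rabs 0 < rho) by now rewrite Rabs_R0.
  rewrite (Derive_n_ext_loc f (PSeries c)).
  - rewrite Derive_n_coef.
    + field. apply INR_fact_neq_0.
    + rewrite <- Rabs_R0. now apply pow_sum_radius with (1 := H).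
  - apply filter_imp with (2 := locally_Rabs_lt 0 rho H0).
    intros x Hx. now apply pow_sum_PSeries with rho.
Qed.

(** Differentiation in [s] commutes with taking Taylor coefficients in [t]. This is what turns the
    flow equation into a recursion for functions of [s]. *)
Definition t_expansion (f : R -> R -> R) (s rho : R) : Prop :=
  pow_sum (fun n => tcoef f n s) (f s) rho /\
  pow_sum (fun n => Derive (tcoef f n) s) (fun t => Derive (fun s' => f s' t) s) rho /\
  (forall t, Rabs t < rho -> ex_derive (fun s' => f s' t) s) /\
  (forall n, ex_derive (tcoef f n) s).

Lemma t_expansion_le (f : R -> R -> R) (s rho rho' : R) :
  rho' <= rho -> t_expansion f s rho -> t_expansion f s rho'.
Proof.
  intros Hle (H1 & H2 & H3 & H4).
  repeat split; eauto using pow_sum_le. intros t Ht. apply H3. lra.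
Qed.

(** The expansion at [(s, 0)] also expands the slices at nearby [s + x], so [tcoef f n (s + x)] is
    the power series of column [n]. Its value and derivative at [x = 0] are [c 0 n] and [c 1 n]. *)
Lemma expands_tcoef (f : R -> R -> R) (s : R) (c : nat -> nat -> R) (rho : R) :
  0 < rho -> expands f s 0 c rho ->
  t_expansion f s rho /\ forall n, tcoef f n s = c 0%nat n.
Proof.
  intros Hrho Hf.
  assert (E : forall x n, Rabs x < rho -> tcoef f n (s + x) = PSeries (fun m => c m n) x).
  { intros x n Hx. unfold tcoef.
    apply (pow_sum_Derive_n (fun n => PSeries (fun m => c m n) x) _ rho); auto.
    apply pow_sum_ext with (3 := expands_slice f s 0 c rho Hf x Hx); auto.
    intros y _. now rewrite Rplus_0_l. }
  assert (E0 : forall n, tcoef f n s = c 0%nat n).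
  { intros n. replace s with (s + 0) by ring.
    rewrite E by now rewrite Rabs_R0. apply PSeries_0. }
  assert (E1 : forall n, is_derive (tcoef f n) s (c 1%nat n)).
  { intros n. replace s with (s + 0) by ring. apply is_derive_shift.
    replace (c 1%nat n) with (PSeries (PS_derive (fun m => c m n)) 0)
      by (rewrite PSeries_0; unfold PS_derive; simpl; ring).
    apply pow_sum_is_derive with rho; [|now rewrite Rabs_R0].
    apply pow_sum_ext with (3 := expands_col f s 0 c rho Hrho Hf n); auto.
    intros x Hx. symmetry. now apply E. }
  assert (D : forall t, Rabs t < rho -> is_derive (fun s' => f s' t) s (PSeries (c 1%nat) t)).
  { intros t Ht. generalize (expands_is_derive f s 0 c rho Hrho Hf t Ht).
    apply is_derive_ext. intros s'. now rewrite Rplus_0_l. }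
  split; auto. repeat split.
  - apply pow_sum_ext with (3 := expands_center f s 0 c rho Hrho Hf); auto.
    intros y _. now rewrite Rplus_0_l.
  - apply pow_sum_ext with (3 := expands_row f s 0 c rho Hrho Hf 1).
    + intros n. symmetry. now apply is_derive_unique.
    + intros t Ht. symmetry. now apply is_derive_unique, D.
  - intros t Ht. eexists. now apply D.
  - intros n. eexists. apply E1.
Qed.

Lemma analytic2_t_expansion (f : R -> R -> R) (s : R) :
  analytic2_at f s 0 -> exists rho, 0 < rho /\ t_expansion f s rho.
Proof.
  intros H. destruct (analytic2_expands f s 0 H) as (c & rho & Hrho & Hc).
  exists rho. split; auto. now apply (expands_tcoef f s c).
Qed.

Lemma analytic2_slice (f : R -> R -> R) (s t : R) :
  analytic2_at f s t -> exists c rho, 0 < rho /\ pow_sum c (fun x => f s (t + x)) rho.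
Proof.
  intros H. destruct (analytic2_expands f s t H) as (c & rho & Hrho & Hc).
  exists (c 0%nat), rho. split; auto. now apply expands_center.
Qed.

(** * Identity theorem *)

Lemma pow_sum_left_zero_0 (c : nat -> R) (f : R -> R) (rho delta : R) :
  0 < rho -> 0 < delta -> pow_sum c f rho -> (forall x, - delta < x < 0 -> f x = 0) ->
  c 0%nat = 0.
Proof.
  intros Hrho Hdelta H Hz.
  assert (H0 : Rabs 0 < rho) by now rewrite Rabs_R0.
  destruct (Req_dec (c 0%nat) 0) as [E|E]; auto. exfalso.
  assert (Hpos := Rabs_pos_lt _ E).
  assert (Hcont : continuity_pt (PSeries c) 0).
  { apply PSeries_continuity. now apply pow_sum_radius with (1 := H). }
  destruct (Hcont _ Hpos) as (alp & Halp & Hd).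
  set (e := Rmin alp (Rmin delta rho)).
  assert (He : 0 < e /\ e <= alp /\ e <= delta /\ e <= rho).
  { unfold e. generalize (Rmin_l alp (Rmin delta rho)) (Rmin_r alp (Rmin delta rho))
      (Rmin_l delta rho) (Rmin_r delta rho).
    repeat split; try lra. repeat apply Rmin_glb_lt; lra. }
  (* At [- e / 2] the function vanishes, yet continuity with tolerance [|c 0|] places its value at a
     distance less than [|c 0|] from [c 0]. *)
  assert (Ha : Rabs (- e / 2) = e / 2).
  { rewrite Rabs_left1; lra. }
  specialize (Hd (- e / 2)). simpl in Hd. unfold Rdist, D_x, no_cond in Hd.
  rewrite PSeries_0, Rminus_0_r, Ha in Hd.
  rewrite <- (pow_sum_PSeries c f rho) in Hd by (auto; lra).
  rewrite Hz in Hd by lra.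
  rewrite Rminus_0_l, Rabs_Ropp in Hd.
  apply (Rlt_irrefl (Rabs (c 0%nat))), Hd. repeat split; auto; lra.
Qed.

(** Vanishing on one side is all that is known at a supremum. Once [c 0 = 0], the quotient [f x / x]
    has the shifted coefficients and still vanishes on the left, so the induction goes on. *)
Lemma pow_sum_left_zero (n : nat) (c : nat -> R) (f : R -> R) (rho delta : R) :
  0 < rho -> 0 < delta -> pow_sum c f rho -> (forall x, - delta < x < 0 -> f x = 0) ->
  c n = 0.
Proof.
  intros Hrho Hdelta. revert c f. induction n as [|n IH]; intros c f H Hz.
  - now apply pow_sum_left_zero_0 with f rho delta.
  - assert (E := pow_sum_left_zero_0 c f rho delta Hrho Hdelta H Hz).
    (* At [x = 0] the quotient is given the value of the shifted series, [c 1]. *)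
    apply (IH (PS_decr_1 c) (fun x => if Req_dec_T x 0 then c 1%nat else f x / x)).
    + intros x Hx. destruct (Req_dec_T x 0) as [Ex|Ex].
      * subst x. apply (is_pseries_R (PS_decr_1 c) 0 (c 1%nat)), (is_pseries_0 (PS_decr_1 c)).
      * apply (is_series_eq (fun n => / x * (c (S n) * x ^ S n))).
        { intros k. unfold PS_decr_1. simpl. field. exact Ex. }
        replace (f x / x) with (/ x * f x) by (unfold Rdiv; ring).
        apply (is_series_scal (/ x) (fun n => c (S n) * x ^ S n)).
        apply (is_series_incr_1 (fun n => c n * x ^ n)).
        rewrite E. replace (plus (f x) _) with (f x); [now apply H|].
        unfold plus; simpl. ring.
    + intros x Hx. destruct (Req_dec_T x 0); [lra|]. rewrite Hz by auto. field. auto.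
Qed.

(** Let [T] be the supremum of the [u <= t] such that [f] vanishes on [[0,u]]. The expansion at [T]
    vanishes on the left, hence is zero, so [f] vanishes on both sides of [T]; this contradicts the
    choice of [T] unless [T = t]. *)
Lemma analytic_zero_right (f : R -> R) (e rho t : R) :
  0 < rho -> (forall u, Rabs u < rho -> f u = 0) ->
  (forall u, 0 <= u < e -> exists c r, 0 < r /\ pow_sum c (fun x => f (u + x)) r) ->
  0 <= t < e -> f t = 0.
Proof.
  intros Hrho Hz Han Ht.
  set (P := fun u => 0 <= u <= t /\ forall v, 0 <= v <= u -> f v = 0).
  destruct (completeness P) as (T & HT1 & HT2).
  { exists t. intros u [Hu _]. lra. }
  { exists 0. split; [lra|]. intros v Hv. replace v with 0 by lra.
    apply Hz. now rewrite Rabs_R0. }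
  assert (HTt : T <= t) by (apply HT2; intros u [Hu _]; lra).
  assert (HP0 : P (Rmin (rho / 2) t)).
  { assert (A := Rmin_l (rho / 2) t). assert (B := Rmin_r (rho / 2) t).
    split; [split; [apply Rmin_glb; lra|lra]|].
    intros v Hv. apply Hz. rewrite Rabs_pos_eq; lra. }
  assert (HT0 := HT1 _ HP0).
  assert (Hbelow : forall v, 0 <= v < T -> f v = 0).
  { intros v Hv. destruct (Req_dec (f v) 0) as [|Hne]; auto. exfalso.
    assert (T <= v); [|lra]. apply HT2. intros u [Hu Hu'].
    destruct (Rle_lt_dec u v); auto. exfalso. apply Hne, Hu'. lra. }
  destruct (Req_dec t 0) as [->|Hn0]; [apply Hz; now rewrite Rabs_R0|].
  assert (HTpos : 0 < T).
  { apply Rlt_le_trans with (2 := HT0). apply Rmin_glb_lt; lra. }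
  destruct (Han T) as (c & r & Hr & Hc); [lra|].
  assert (Hc0 : forall n, c n = 0).
  { intros n. apply pow_sum_left_zero with (fun x => f (T + x)) r T; auto.
    intros x Hx. apply Hbelow. lra. }
  assert (Hnear : forall v, Rabs (v - T) < r -> f v = 0).
  { intros v Hv. replace v with (T + (v - T)) by ring.
    rewrite (pow_sum_PSeries _ _ _ _ Hc Hv).
    unfold PSeries. rewrite (Series_ext _ (fun n => 0 * c n)).
    - rewrite Series_scal_l. ring.
    - intros n. rewrite Hc0. ring. }
  destruct (Rle_lt_dec t T) as [Hle|Hlt].
  - apply Hnear. replace (t - T) with 0 by lra. now rewrite Rabs_R0.
  - exfalso. assert (HP : P (Rmin t (T + r / 2))).
    { assert (A := Rmin_l t (T + r / 2)). assert (B := Rmin_r t (T + r / 2)).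
      split; [split; [apply Rmin_glb; lra|lra]|].
      intros v Hv. destruct (Rlt_le_dec v T); [apply Hbelow; lra|].
      apply Hnear. rewrite Rabs_pos_eq; lra. }
    assert (Hle := HT1 _ HP). assert (T < Rmin t (T + r / 2)); [|lra].
    apply Rmin_glb_lt; lra.
Qed.

Lemma analytic_zero (f : R -> R) (e rho t : R) :
  0 < rho -> (forall u, Rabs u < rho -> f u = 0) ->
  (forall u, - e < u < e -> exists c r, 0 < r /\ pow_sum c (fun x => f (u + x)) r) ->
  - e < t < e -> f t = 0.
Proof.
  intros Hrho Hz Han Ht. destruct (Rle_lt_dec 0 t) as [H|H].
  - apply analytic_zero_right with e rho; auto; [|lra]. intros u Hu. apply Han. lra.
  - rewrite <- (Ropp_involutive t).
    apply (analytic_zero_right (fun u => f (- u)) e rho); auto; [| |lra].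
    + intros u Hu. apply Hz. now rewrite Rabs_Ropp.
    + intros u Hu. destruct (Han (- u)) as (c & r & Hr & Hc); [lra|].
      exists (fun n => (-1) ^ n * c n), r. split; auto. intros x Hx.
      replace (- (u + x)) with (- u + - x) by ring.
      apply is_series_eq with (2 := Hc (- x) ltac:(now rewrite Rabs_Ropp)).
      intros n. replace (- x) with (-1 * x) by ring. rewrite Rpow_mult_distr. ring.
Qed.

(** * Rearranging finite sums *)

Lemma sum_swap (a : nat -> nat -> R) (m n : nat) :
  sum_f_R0 (fun i => sum_f_R0 (a i) n) m = sum_f_R0 (fun j => sum_f_R0 (fun i => a i j) m) n.
Proof.
  induction m as [|m IH]; simpl; auto.
  rewrite IH, <- sum_plus. reflexivity.
Qed.

Lemma sum_rev (a : nat -> R) (n : nat) :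
  sum_f_R0 (fun k => a (n - k)%nat) n = sum_f_R0 a n.
Proof.
  induction n as [|n IH]; auto.
  rewrite decomp_sum by lia. simpl pred. rewrite tech5, <- IH, Rplus_comm.
  f_equal.
Qed.

(** * Majorants *)

(* [hc p m] is the coefficient of [x^m] in [(1 - x)^(-p)]. *)
Fixpoint hc (p : nat) : nat -> R :=
  match p with
  | O => fun m => match m with O => 1 | S _ => 0 end
  | S p' => fun m => sum_f_R0 (hc p') m
  end.

Lemma hc_S_S (p m : nat) : hc (S p) (S m) = hc (S p) m + hc p (S m).
Proof. reflexivity. Qed.

Lemma hc_0 (p : nat) : hc p 0 = 1.
Proof. induction p; auto. Qed.

Lemma hc_1 (m : nat) : hc 1 m = 1.
Proof. induction m as [|m IH]; auto. rewrite hc_S_S, IH. simpl. ring. Qed.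

(** The coefficient form of [(1 - x)^(-p) (1 - x)^(-q) = (1 - x)^(-p-q)]. The double induction rests
    on Pascal's rule [hc_S_S]. *)
Lemma hc_conv (p q m : nat) : sum_f_R0 (fun j => hc p j * hc q (m - j)) m = hc (p + q) m.
Proof.
  revert m. induction p as [|p IHp].
  - intros [|m]; simpl plus; [simpl; ring|].
    rewrite decomp_sum by lia. simpl pred. rewrite hc_0, Nat.sub_0_r.
    rewrite (sum_eq _ (fun _ => 0)).
    + rewrite sum_cte, Nat.add_0_l. ring.
    + intros i _. simpl. ring.
  - induction m as [|m IHm].
    + cbn [sum_f_R0 plus]. rewrite !hc_0. ring.
    + change (S p + q)%nat with (S (p + q)) in *.
      rewrite hc_S_S, <- IHm, <- IHp.
      rewrite (decomp_sum _ (S m)) by lia. rewrite (decomp_sum (fun j => hc p j * _) (S m)) by lia.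
      cbn [pred]. rewrite !hc_0, !Nat.sub_0_r.
      transitivity (1 * hc q (S m) +
        (sum_f_R0 (fun j => hc (S p) j * hc q (m - j)) m +
         sum_f_R0 (fun j => hc p (S j) * hc q (S m - S j)) m)); [|ring].
      f_equal. rewrite <- sum_plus. apply sum_eq. intros i _. rewrite hc_S_S.
      change (S m - S i)%nat with (m - i)%nat. ring.
Qed.

(** As [hc (S p) m] is the binomial coefficient of [m + p] over [m], both identities are absorption
    rules. They are interlaced: the shift rule at [m] gives the derivative rule at [m], and this
    gives the shift rule at [m + 1]. *)
Lemma hc_der_of_shift (m : nat) :
  (forall p, (INR m + INR (S p)) * hc (S p) m = INR (S p) * hc (S (S p)) m) ->
  forall p, INR (S m) * hc p (S m) = INR p * hc (S p) m.
Proof.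
  intros H p. induction p as [|p IH]; [simpl; ring|].
  rewrite <- H, hc_S_S, Rmult_plus_distr_l, IH, !S_INR. ring.
Qed.

Lemma hc_shift (m p : nat) : (INR m + INR (S p)) * hc (S p) m = INR (S p) * hc (S (S p)) m.
Proof.
  revert p. induction m as [|m IH]; intros p.
  - rewrite !hc_0. simpl INR at 1. ring.
  - assert (D := hc_der_of_shift m IH (S p)).
    rewrite (hc_S_S (S p) m), Rmult_plus_distr_l, <- D. ring.
Qed.

(** The coefficient form of the derivative of [(1 - x)^(-p)], namely [p (1 - x)^(-p-1)]. *)
Lemma hc_der (m p : nat) : INR (S m) * hc p (S m) = INR p * hc (S p) m.
Proof. apply hc_der_of_shift, hc_shift. Qed.

Lemma hc_bounds (p m : nat) : 0 <= hc p m <= 2 ^ (p + m).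
Proof.
  revert m. induction p as [|p IHp].
  - intros [|m]; simpl; [lra|]. assert (0 < 2 ^ m) by (apply pow_lt; lra). lra.
  - induction m as [|m IHm].
    + rewrite hc_0. assert (1 <= 2 ^ (S p + 0)); [|lra]. apply pow_R1_Rle. lra.
    + rewrite hc_S_S. specialize (IHp (S m)).
      replace (2 ^ (S p + S m)) with (2 ^ (S p + m) + 2 ^ (p + S m)); [lra|].
      rewrite !Nat.add_succ_r. simpl. ring.
Qed.

(** Majorisation of [f (s + x)] by [B (1 - K x)^(-p)]. The radius [/ K] does not depend on [p]. *)
Definition maj (f : R -> R) (s K B : R) (p : nat) : Prop :=
  exists c, (forall m, Rabs (c m) <= B * (K ^ m * hc p m)) /\ pow_sum c (fun x => f (s + x)) (/ K).

Section Majorants.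
Variables (s K : R).
Hypothesis HK : 0 < K.

Lemma maj_weight_nonneg (p m : nat) : 0 <= K ^ m * hc p m.
Proof. apply Rmult_le_pos; [apply pow_le; lra | apply hc_bounds]. Qed.

Lemma maj_le (f : R -> R) (B B' : R) (p : nat) : B <= B' -> maj f s K B p -> maj f s K B' p.
Proof.
  intros Hle (c & Hc & Hs). exists c. split; auto. intros m.
  apply Rle_trans with (1 := Hc m). apply Rmult_le_compat_r; auto. apply maj_weight_nonneg.
Qed.

Lemma maj_ext (f g : R -> R) (B : R) (p : nat) :
  (forall x, f x = g x) -> maj f s K B p -> maj g s K B p.
Proof.
  intros E (c & Hc & Hs). exists c. split; auto.
  apply pow_sum_ext with (3 := Hs); auto.
Qed.

Lemma maj_nonneg (f : R -> R) (B : R) (p : nat) : maj f s K B p -> 0 <= B.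
Proof.
  intros (c & Hc & _). specialize (Hc 0%nat). rewrite hc_0 in Hc. simpl in Hc.
  generalize (Rabs_pos (c 0%nat)). lra.
Qed.

Lemma maj_plus (f g : R -> R) (A B : R) (p : nat) :
  maj f s K A p -> maj g s K B p -> maj (fun x => f x + g x) s K (A + B) p.
Proof.
  intros (c & Hc & Hcs) (d & Hd & Hds). exists (fun n => c n + d n). split.
  - intros m. rewrite Rmult_plus_distr_r. apply Rle_trans with (1 := Rabs_triang _ _).
    now apply Rplus_le_compat.
  - now apply pow_sum_plus.
Qed.

Lemma maj_scal (k : R) (f : R -> R) (B : R) (p : nat) :
  maj f s K B p -> maj (fun x => k * f x) s K (Rabs k * B) p.
Proof.
  intros (c & Hc & Hcs). exists (fun n => k * c n). split.
  - intros m. rewrite Rabs_mult, Rmult_assoc.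
    apply Rmult_le_compat_l; auto. apply Rabs_pos.
  - now apply pow_sum_scal.
Qed.

Lemma maj_sum (f : nat -> R -> R) (B : nat -> R) (p N : nat) :
  (forall i, (i <= N)%nat -> maj (f i) s K (B i) p) ->
  maj (fun x => sum_f_R0 (fun i => f i x) N) s K (sum_f_R0 B N) p.
Proof.
  induction N as [|N IH]; intros H; simpl.
  - now apply (H 0%nat).
  - apply maj_plus; [apply IH; intros; apply H; lia | apply H; lia].
Qed.

Lemma maj_mult (f g : R -> R) (A B : R) (p q : nat) :
  maj f s K A p -> maj g s K B q -> maj (fun x => f x * g x) s K (A * B) (p + q).
Proof.
  intros (c & Hc & Hcs) (d & Hd & Hds). exists (PS_mult c d). split.
  - intros m. unfold PS_mult. apply Rle_trans with (1 := Rsum_abs _ _).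
    rewrite <- hc_conv, <- !Rmult_assoc, scal_sum. apply sum_Rle. intros j Hj.
    rewrite Rabs_mult.
    apply Rle_trans with (A * (K ^ j * hc p j) * (B * (K ^ (m - j) * hc q (m - j)))).
    + apply Rmult_le_compat; auto using Rabs_pos.
    + apply Req_le. replace (K ^ m) with (K ^ j * K ^ (m - j)); [ring|].
      rewrite <- pow_add. f_equal. lia.
  - now apply pow_sum_mult.
Qed.

Lemma maj_derive (f : R -> R) (B : R) (p : nat) :
  maj f s K B p -> maj (Derive f) s K (B * K * INR p) (S p).
Proof.
  intros (c & Hc & Hcs). exists (PS_derive c). split.
  - intros m. unfold PS_derive. rewrite Rabs_mult, Rabs_pos_eq by apply pos_INR.
    apply Rle_trans with (INR (S m) * (B * (K ^ S m * hc p (S m)))).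
    + apply Rmult_le_compat_l; auto. apply pos_INR.
    + apply Req_le. transitivity (B * K * K ^ m * (INR (S m) * hc p (S m))).
      * simpl pow. ring.
      * rewrite hc_der. ring.
  - apply pow_sum_ext with (3 := pow_sum_derive _ _ _ Hcs); auto.
    intros x Hx. transitivity (PSeries (PS_derive c) x).
    + apply is_derive_unique. now apply pow_sum_is_derive with (1 := Hcs).
    + symmetry. apply is_derive_unique, is_derive_shift.
      now apply pow_sum_is_derive with (1 := Hcs).
Qed.

End Majorants.

(** * Weights stable under convolution *)

Definition sqw (n : nat) : R := / INR (S n) ^ 2.

(** Telescoping: [1 / (x + 1)^2] is less than [1 / x - 1 / (x + 1)]. *)
Lemma sum_sqw (n : nat) : sum_f_R0 sqw n <= 2 - / INR (S n).
Proof.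
  induction n as [|n IH].
  - unfold sqw. simpl. lra.
  - rewrite tech5. unfold sqw at 2. rewrite (S_INR (S n)).
    assert (H : 0 < INR (S n)) by (apply lt_0_INR; lia).
    set (x := INR (S n)) in *.
    assert (E : / x - / (x + 1) - / (x + 1) ^ 2 = / (x * (x + 1) ^ 2)) by (field; lra).
    assert (0 < / (x * (x + 1) ^ 2)).
    { apply Rinv_0_lt_compat, Rmult_lt_0_compat; auto. apply pow_lt. lra. }
    lra.
Qed.

Lemma sqw_pos (n : nat) : 0 < sqw n.
Proof. apply Rinv_0_lt_compat, pow_lt, lt_0_INR. lia. Qed.

(** With [x = k + 1], [y = n - k + 1] and [x + y = n + 2], the product [1 / (x y)^2] is the square
    of [(1 / x + 1 / y) / (x + y)], hence at most [2 (1 / x^2 + 1 / y^2) / (x + y)^2]. Each of the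
    two sums of squares is below 2, which gives [2 * (2 + 2) = 8]. *)
Lemma sqw_conv (n : nat) :
  sum_f_R0 (fun k => sqw k * sqw (n - k)) n <= 8 * sqw (S n).
Proof.
  apply Rle_trans with (sum_f_R0 (fun k => (sqw k + sqw (n - k)) * (2 * sqw (S n))) n).
  - apply sum_Rle. intros k Hk. unfold sqw.
    assert (Hx : 0 < INR (S k)) by (apply lt_0_INR; lia).
    assert (Hy : 0 < INR (S (n - k))) by (apply lt_0_INR; lia).
    replace (INR (S (S n))) with (INR (S k) + INR (S (n - k)))
      by (rewrite <- plus_INR; f_equal; lia).
    set (x := INR (S k)) in *. set (y := INR (S (n - k))) in *.
    assert (E : (/ x ^ 2 + / y ^ 2) * (2 * / (x + y) ^ 2) - / x ^ 2 * / y ^ 2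
      = (x - y) ^ 2 * / (x * y * (x + y)) ^ 2) by (field; lra).
    assert (0 <= (x - y) ^ 2 * / (x * y * (x + y)) ^ 2); [|lra].
    apply Rmult_le_pos; [apply pow2_ge_0|].
    apply Rlt_le, Rinv_0_lt_compat, pow_lt. repeat apply Rmult_lt_0_compat; lra.
  - rewrite <- scal_sum, sum_plus, (sum_rev sqw).
    assert (H := sum_sqw n). assert (Hw := sqw_pos (S n)).
    assert (0 < / INR (S n)) by (apply Rinv_0_lt_compat, lt_0_INR; lia).
    replace (8 * sqw (S n)) with (2 * sqw (S n) * 4) by ring.
    apply Rmult_le_compat_l; lra.
Qed.

(** * The cross product as a bilinear map with bounded coefficients *)

Definition cross_coef (i j k : nat) : R := G2phi (basis7 i) (basis7 j) (basis7 k).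

Lemma cross7_bilinear (u v : Vec) (k : nat) :
  cross7 u v k = sum_f_R0 (fun i => sum_f_R0 (fun j => cross_coef i j k * (u i * v j)) 6) 6.
Proof.
  unfold cross7, cross_coef. generalize (basis7 k) as w. intros w.
  unfold G2phi, dx, det3. cbn [sum_f_R0 Nat.sub basis7 Nat.eqb]. ring.
Qed.

(** A crude bound suffices: seven determinants, each with six products of entries 0 or 1. *)
Lemma cross_coef_bound (i j k : nat) : Rabs (cross_coef i j k) <= 42.
Proof.
  assert (Hb : forall l m, Rabs (basis7 l m) <= 1).
  { intros l m. unfold basis7. destruct (Nat.eqb m l); rewrite ?Rabs_R0, ?Rabs_R1; lra. }
  assert (Hm : forall x y A B, Rabs x <= A -> Rabs y <= B -> Rabs (x * y) <= A * B).
  { intros. rewrite Rabs_mult. apply Rmult_le_compat; auto using Rabs_pos. }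
  assert (Hp : forall x y A B, Rabs x <= A -> Rabs y <= B -> Rabs (x + y) <= A + B).
  { intros. generalize (Rabs_triang x y). lra. }
  assert (Hs : forall x y A B, Rabs x <= A -> Rabs y <= B -> Rabs (x - y) <= A + B).
  { intros. unfold Rminus. apply Hp; auto. now rewrite Rabs_Ropp. }
  assert (Hdx : forall p q r, Rabs (dx p q r (basis7 i) (basis7 j) (basis7 k)) <= 6).
  { intros p q r. unfold dx, det3.
    replace 6 with (1 * (1 * 1 + 1 * 1) + 1 * (1 * 1 + 1 * 1) + 1 * (1 * 1 + 1 * 1)) by ring.
    repeat first [apply Hb | apply Hs | apply Hp | apply Hm]. }
  unfold cross_coef, G2phi.
  replace 42 with (6 + 6 + 6 + 6 + 6 + 6 + 6) by ring.
  repeat first [apply Hdx | apply Hs | apply Hp].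
Qed.

(** The Cauchy product of two vector power series with respect to [cross7]. *)
Definition conv7 (U V : nat -> Vec) (n k : nat) : R :=
  sum_f_R0 (fun l => cross7 (U l) (V (n - l)%nat) k) n.

Lemma pow_sum_cross7 (U V : nat -> Vec) (u v : R -> Vec) (rho : R) (k : nat) :
  (forall i, (i < 7)%nat -> pow_sum (fun n => U n i) (fun t => u t i) rho) ->
  (forall i, (i < 7)%nat -> pow_sum (fun n => V n i) (fun t => v t i) rho) ->
  pow_sum (fun n => conv7 U V n k) (fun t => cross7 (u t) (v t) k) rho.
Proof.
  intros HU HV.
  apply pow_sum_ext with
    (c := fun n => sum_f_R0 (fun i => sum_f_R0 (fun j => cross_coef i j k *
            PS_mult (fun n => U n i) (fun n => V n j) n) 6) 6)
    (f := fun t => sum_f_R0 (fun i => sum_f_R0 (fun j => cross_coef i j k *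
            (u t i * v t j)) 6) 6).
  - intros n. unfold conv7.
    rewrite (sum_eq (fun l => cross7 _ _ _)
      (fun l => sum_f_R0 (fun i => sum_f_R0 (fun j =>
         cross_coef i j k * (U l i * V (n - l)%nat j)) 6) 6))
      by (intros; apply cross7_bilinear).
    rewrite (sum_swap _ n 6). apply sum_eq. intros i _.
    rewrite (sum_swap _ n 6). apply sum_eq. intros j _.
    unfold PS_mult. rewrite scal_sum. apply sum_eq. intros l _. ring.
  - intros t _. symmetry. apply cross7_bilinear.
  - apply (pow_sum_sum (fun i n => sum_f_R0 (fun j => cross_coef i j k *
            PS_mult (fun n => U n i) (fun n => V n j) n) 6)
        (fun i t => sum_f_R0 (fun j => cross_coef i j k * (u t i * v t j)) 6)).
    intros i Hi.
    apply (pow_sum_sum (fun j n => cross_coef i j k *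
            PS_mult (fun n => U n i) (fun n => V n j) n)
        (fun j t => cross_coef i j k * (u t i * v t j))).
    intros j Hj.
    apply (pow_sum_scal (cross_coef i j k)
      (PS_mult (fun n => U n i) (fun n => V n j)) (fun t => u t i * v t j)).
    apply (pow_sum_mult (fun n => U n i) (fun n => V n j) (fun t => u t i) (fun t => v t j));
      [apply HU | apply HV]; lia.
Qed.

(** [2058 = 7 * 7 * 42]: the number of index pairs times the bound on [cross_coef]. *)
Lemma maj_cross7 (u v : R -> Vec) (s K A B : R) (p q k : nat) :
  0 < K ->
  (forall i, (i < 7)%nat -> maj (fun x => u x i) s K A p) ->
  (forall i, (i < 7)%nat -> maj (fun x => v x i) s K B q) ->
  maj (fun x => cross7 (u x) (v x) k) s K (2058 * (A * B)) (p + q).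
Proof.
  intros HK Hu Hv.
  assert (HAB : 0 <= A * B).
  { apply Rmult_le_pos; [apply maj_nonneg with (1 := Hu 0%nat ltac:(lia))
                        |apply maj_nonneg with (1 := Hv 0%nat ltac:(lia))]. }
  apply maj_ext with (fun x => sum_f_R0 (fun i => sum_f_R0 (fun j =>
     cross_coef i j k * (u x i * v x j)) 6) 6).
  { intros x. symmetry. apply cross7_bilinear. }
  apply maj_le with (sum_f_R0 (fun i => sum_f_R0 (fun j => 42 * (A * B)) 6) 6); auto.
  { rewrite !sum_cte. simpl INR. lra. }
  apply (maj_sum s K (fun i x => sum_f_R0 (fun j => cross_coef i j k * (u x i * v x j)) 6)).
  intros i Hi.
  apply (maj_sum s K (fun j x => cross_coef i j k * (u x i * v x j))).
  intros j Hj.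
  apply maj_le with (Rabs (cross_coef i j k) * (A * B)); auto.
  { apply Rmult_le_compat_r; auto. apply cross_coef_bound. }
  apply maj_scal. apply maj_mult; [apply Hu | apply Hv]; lia.
Qed.

(** * The Taylor coefficients in t *)

Lemma cross7_ext (u u' v v' : Vec) (k : nat) :
  veq u u' -> veq v v' -> cross7 u v k = cross7 u' v' k.
Proof.
  intros Hu Hv. rewrite !cross7_bilinear. apply sum_eq. intros i Hi.
  apply sum_eq. intros j Hj. rewrite Hu, Hv by lia. reflexivity.
Qed.

Lemma conv7_ext (U U' V V' : nat -> Vec) (n k : nat) :
  (forall l, (l <= n)%nat -> veq (U l) (U' l)) ->
  (forall l, (l <= n)%nat -> veq (V l) (V' l)) ->
  conv7 U V n k = conv7 U' V' n k.
Proof.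
  intros HU HV. apply sum_eq. intros l Hl. apply cross7_ext; [apply HU | apply HV]; lia.
Qed.

(* [flow_table X0 n l] is the [l]-th Taylor coefficient in [t], correct for [l <= n]:
   the recursion for coefficient [n + 1] uses all the earlier ones. The index [true]
   stands for the direction [phi], [false] for [psi]. *)
Fixpoint flow_table (X0 : bool -> R -> Vec) (n : nat) : nat -> bool -> R -> Vec :=
  match n with
  | O => fun _ => X0
  | S n' => fun l =>
      if (l <=? n')%nat then flow_table X0 n' l
      else fun b s k => / INR (S n') *
        conv7 (fun l => flow_table X0 n' l true s)
              (fun l j => Derive (fun s' => flow_table X0 n' l b s' j) s) n' k
  end.

Definition flow_coef (X0 : bool -> R -> Vec) (n : nat) : bool -> R -> Vec :=
  flow_table X0 n n.

Lemma flow_table_stable (X0 : bool -> R -> Vec) (n l : nat) :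
  (l <= n)%nat -> flow_table X0 n l = flow_coef X0 l.
Proof.
  induction n as [|n IH]; intros Hl.
  - now replace l with O by lia.
  - destruct (Nat.eq_dec l (S n)) as [->|Hne]; auto.
    simpl. rewrite (proj2 (Nat.leb_le l n)) by lia. apply IH. lia.
Qed.

Lemma flow_coef_S (X0 : bool -> R -> Vec) (n : nat) (b : bool) (s : R) (k : nat) :
  flow_coef X0 (S n) b s k = / INR (S n) *
    conv7 (fun l => flow_coef X0 l true s)
          (fun l j => Derive (fun s' => flow_coef X0 l b s' j) s) n k.
Proof.
  unfold flow_coef at 1. cbn [flow_table].
  rewrite (proj2 (Nat.leb_gt (S n) n)) by lia. f_equal. apply conv7_ext; intros l Hl i Hi.
  - now rewrite flow_table_stable.
  - now rewrite flow_table_stable.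
Qed.

(** [32928 = 2058 * 2 * 8]: 2058 from the cross product, 2 from [2 (n - l) + 1 <= 2 (n + 1)] in the
    derivative, 8 from [sqw_conv]. *)
Lemma flow_coef_maj (X0 : bool -> R -> Vec) (s K M : R) :
  0 < K -> 0 <= M ->
  (forall b i, (i < 7)%nat -> maj (fun x => X0 b x i) s K M 1) ->
  forall n b i, (i < 7)%nat ->
    maj (fun x => flow_coef X0 n b x i) s K (M * (32928 * K * M) ^ n * sqw n) (2 * n + 1).
Proof.
  intros HK HM H0 n. set (E := 32928 * K * M).
  assert (HE : 0 <= E) by (unfold E; repeat apply Rmult_le_pos; lra).
  induction n as [n IH] using (well_founded_ind Nat.lt_wf_0). intros b i Hi. destruct n as [|n].
  - apply maj_le with M; auto. unfold sqw. simpl. lra.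
  - apply maj_ext with (fun x => / INR (S n) *
      conv7 (fun l => flow_coef X0 l true x)
            (fun l j => Derive (fun s' => flow_coef X0 l b s' j) x) n i).
    { intros x. symmetry. apply flow_coef_S. }
    assert (HS : 0 < INR (S n)) by (apply lt_0_INR; lia).
    set (D := fun l => 2058 * ((M * E ^ l * sqw l) *
       ((M * E ^ (n - l) * sqw (n - l)) * K * INR (2 * (n - l) + 1)))).
    apply maj_le with (Rabs (/ INR (S n)) * sum_f_R0 D n); auto.
    + rewrite Rabs_pos_eq by (apply Rlt_le, Rinv_0_lt_compat; auto).
      apply Rle_trans with (/ INR (S n) *
        sum_f_R0 (fun l => sqw l * sqw (n - l) * (4116 * K * M * M * E ^ n * INR (S n))) n).
      * apply Rmult_le_compat_l; [apply Rlt_le, Rinv_0_lt_compat; auto|].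
        apply sum_Rle. intros l Hl. unfold D.
        replace (E ^ n) with (E ^ l * E ^ (n - l)) by (rewrite <- pow_add; f_equal; lia).
        assert (Hw := sqw_pos l). assert (Hw' := sqw_pos (n - l)).
        assert (INR (2 * (n - l) + 1) <= 2 * INR (S n)).
        { change 2 with (INR 2). rewrite <- mult_INR. apply le_INR. lia. }
        apply Rle_trans with (2058 * (M * E ^ l * sqw l) * (M * E ^ (n - l) * sqw (n - l)) * K
          * (2 * INR (S n))); [|apply Req_le; ring].
        rewrite <- !Rmult_assoc. apply Rmult_le_compat_l with
          (r := 2058 * M * E ^ l * sqw l * M * E ^ (n - l) * sqw (n - l) * K) in H.
        -- rewrite <- !Rmult_assoc in H. exact H.
        -- repeat apply Rmult_le_pos; auto using pow_le; lra.
      * rewrite <- scal_sum.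
        apply Rle_trans with (/ INR (S n) *
          ((4116 * K * M * M * E ^ n * INR (S n)) * (8 * sqw (S n)))).
        -- apply Rmult_le_compat_l; [apply Rlt_le, Rinv_0_lt_compat; auto|].
           apply Rmult_le_compat_l; [|apply sqw_conv].
           repeat apply Rmult_le_pos; auto using pow_le; lra.
        -- apply Req_le. unfold E. simpl pow. field. lra.
    + apply (maj_scal s K (/ INR (S n)) (fun x =>
        conv7 (fun l => flow_coef X0 l true x)
            (fun l j => Derive (fun s' => flow_coef X0 l b s' j) x) n i)).
      apply (maj_sum s K (fun l x => cross7 (flow_coef X0 l true x)
        (fun j => Derive (fun s' => flow_coef X0 (n - l) b s' j) x) i)).
      intros l Hl.
      (* The exponents match exactly: [phi_l] contributes [2 l + 1], the derivative of the other
         factor [2 (n - l) + 2]. *)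
      replace (2 * S n + 1)%nat with ((2 * l + 1) + S (2 * (n - l) + 1))%nat by lia.
      apply (maj_cross7 (fun x => flow_coef X0 l true x)
        (fun x j => Derive (fun s' => flow_coef X0 (n - l) b s' j) x)); auto.
      * intros j Hj. apply IH; auto. lia.
      * intros j Hj. apply maj_derive; auto. apply IH; auto. lia.
Qed.

(** * Uniform majorants of the initial data *)

Lemma ex_series_bounded (a : nat -> R) : ex_series a -> exists M, forall n, Rabs (a n) <= M.
Proof.
  intros H. apply ex_series_lim_0, is_lim_seq_Reals in H.
  destruct (maj_by_pos a (exist _ 0 H)) as (M & _ & HM). now exists M.
Qed.

(** A single [delta] fixes both constants of the majorant. Shrinking it only weakens the claim, so
    the compactness argument has one gauge to control. *)
Lemma analytic1_maj_nearby (f : R -> R) (s0 : R) :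
  analytic1_at f s0 ->
  exists delta, 0 < delta /\
    forall s, Rabs (s - s0) < delta -> maj f s (/ delta) (/ delta) 1.
Proof.
  intros (c & rho & Hrho & Hc).
  destruct (ex_series_bounded (fun n => c n * (rho / 2) ^ n)) as [M HM].
  { exists (f (s0 + rho / 2)). specialize (Hc (s0 + rho / 2)).
    replace (s0 + rho / 2 - s0) with (rho / 2) in Hc by ring.
    apply Hc. rewrite Rabs_pos_eq; lra. }
  assert (HM0 : 0 <= M) by (generalize (HM 0%nat) (Rabs_pos (c 0%nat * (rho / 2) ^ 0)); lra).
  assert (Hgeo : geo_bound M (2 / rho) c).
  { intros m. assert (Hp : 0 < (rho / 2) ^ m) by (apply pow_lt; lra).
    replace ((2 / rho) ^ m) with (/ (rho / 2) ^ m)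
      by (rewrite <- pow_inv; f_equal; field; lra).
    apply Rmult_le_reg_r with (1 := Hp). rewrite Rmult_assoc, Rinv_l, Rmult_1_r by lra.
    specialize (HM m). now rewrite Rabs_mult, (Rabs_pos_eq ((rho / 2) ^ m)) in HM by lra. }
  (* With [r = rho / 8] and [|x0| < delta <= r] the ratio [(2 / rho) (|x0| + r)] is at most [1 / 2],
     so recentring replaces [M] by at most [2 M]. The second bound on [delta] ensures
     [2 M <= / delta]. *)
  set (r := rho / 8). assert (Hr : 0 < r) by (unfold r; lra).
  assert (HK : 0 < 2 / rho) by (apply Rdiv_lt_0_compat; lra).
  set (delta := Rmin r (/ (2 * M + 1))).
  assert (Hdelta : 0 < delta).
  { apply Rmin_glb_lt; auto. apply Rinv_0_lt_compat. lra. }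
  assert (Hdr : delta <= r) by apply Rmin_l.
  assert (HdM : 2 * M <= / delta).
  { apply Rle_trans with (2 * M + 1); [lra|].
    rewrite <- (Rinv_inv (2 * M + 1)). apply Rinv_le_contravar; auto. apply Rmin_r. }
  exists delta. split; auto. intros s Hs. set (x0 := s - s0) in *.
  assert (Hq : 2 / rho * (Rabs x0 + r) <= 1 / 2).
  { replace (1 / 2) with (2 / rho * (2 * r)) by (unfold r; field; lra).
    apply Rmult_le_compat_l; lra. }
  exists (recenter c x0). split.
  - intros m. rewrite hc_1, Rmult_1_r.
    assert (Hb := recenter_geo_bound M (2 / rho) x0 r HM0 (Rlt_le _ _ HK) Hr
      ltac:(lra) c Hgeo m).
    apply Rle_trans with (1 := Hb). apply Rmult_le_compat.
    + apply Rmult_le_pos; auto. apply Rlt_le, Rinv_0_lt_compat. lra.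
    + apply pow_le, Rlt_le, Rinv_0_lt_compat, Hr.
    + apply Rle_trans with (2 := HdM). rewrite (Rmult_comm 2 M). apply Rmult_le_compat_l; auto.
      replace 2 with (/ (1 / 2)) by field. apply Rinv_le_contravar; lra.
    + apply pow_incr. split; [apply Rlt_le, Rinv_0_lt_compat, Hr|].
      now apply Rinv_le_contravar.
  - rewrite Rinv_inv. intros x Hx.
    replace (f (s + x)) with (Series (fun m => c m * (x0 + x) ^ m)).
    + apply recenter_is_series with (M := M) (K := 2 / rho) (r := r); auto; lra.
    + apply is_series_unique. specialize (Hc (s + x)).
      replace (s + x - s0) with (x0 + x) in Hc by (unfold x0; ring). apply Hc.
      generalize (Rabs_triang x0 x). unfold r in *. lra.
Qed.

Lemma maj_shrink (f : R -> R) (s d d' : R) :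
  0 < d' <= d -> maj f s (/ d) (/ d) 1 -> maj f s (/ d') (/ d') 1.
Proof.
  intros [Hd' Hle] (c & Hc & Hs).
  assert (Hi : 0 < / d <= / d').
  { split; [apply Rinv_0_lt_compat; lra | now apply Rinv_le_contravar]. }
  exists c. split.
  - intros m. specialize (Hc m). rewrite hc_1, Rmult_1_r in *.
    apply Rle_trans with (1 := Hc).
    apply Rmult_le_compat; try lra; [apply pow_le; lra | apply pow_incr; lra].
  - rewrite Rinv_inv in *. now apply pow_sum_le with d.
Qed.

Lemma analytic1_uniform_maj (f : R -> R) (a b : R) :
  (forall s, a <= s <= b -> analytic1_at f s) ->
  exists d, 0 < d /\ forall s, a <= s <= b -> maj f s (/ d) (/ d) 1.
Proof.
  intros H.
  assert (Hch : forall t, exists d : posreal, a <= t <= b ->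
     forall s, Rabs (s - t) < d -> maj f s (/ d) (/ d) 1).
  { intros t. destruct (excluded_middle_informative (a <= t <= b)) as [Ht|Ht].
    - destruct (analytic1_maj_nearby f t (H t Ht)) as (d & Hd & Hm).
      exists (mkposreal d Hd). auto.
    (* The gauge must be defined on the whole line; outside [[a,b]] its value is arbitrary. *)
    - exists (mkposreal 1 Rlt_0_1). intros; contradiction. }
  set (delta := fun t => proj1_sig (constructive_indefinite_description _ (Hch t))).
  assert (Hdelta : forall t, a <= t <= b -> forall s, Rabs (s - t) < delta t ->
     maj f s (/ delta t) (/ delta t) 1).
  { intros t. exact (proj2_sig (constructive_indefinite_description _ (Hch t))). }
  destruct (compactness_value_1d a b delta) as [d Hd].
  exists d. split; [apply cond_pos|]. intros s Hs.
  (* [compactness_value_1d] gives the existence of [t] only under a double negation. *)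
  destruct (classic (exists t, a <= t <= b /\ Rabs (s - t) < delta t /\ d <= delta t))
    as [(t & Ht & Hst & Hdt)|Hn].
  - apply maj_shrink with (delta t); auto. split; auto. apply cond_pos.
  - exfalso. exact (Hd s Hs Hn).
Qed.

Lemma common_radius (P : bool -> nat -> R -> Prop) (N : nat) :
  (forall b i d d', 0 < d' <= d -> P b i d -> P b i d') ->
  (forall b i, (i < N)%nat -> exists d, 0 < d /\ P b i d) ->
  exists d, 0 < d /\ forall b i, (i < N)%nat -> P b i d.
Proof.
  intros Hmono. induction N as [|N IH]; intros H.
  - exists 1. split; [lra|]. intros; lia.
  - destruct IH as (d & Hd & IH). { intros; apply H; lia. }
    destruct (H true N) as (d1 & Hd1 & H1); [lia|].
    destruct (H false N) as (d2 & Hd2 & H2); [lia|].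
    set (e := Rmin d (Rmin d1 d2)).
    assert (He : 0 < e <= d /\ e <= d1 /\ e <= d2).
    { unfold e. generalize (Rmin_l d (Rmin d1 d2)) (Rmin_r d (Rmin d1 d2))
        (Rmin_l d1 d2) (Rmin_r d1 d2).
      repeat split; try lra. repeat apply Rmin_glb_lt; lra. }
    exists e. split; [lra|]. intros b i Hi.
    destruct (Nat.eq_dec i N) as [->|Hne].
    + destruct b; [apply Hmono with d1 | apply Hmono with d2]; auto; lra.
    + apply Hmono with d; [lra|]. apply IH. lia.
Qed.

(** * Convergence and analyticity of the series in [t] *)

Definition flow_sum (X0 : bool -> R -> Vec) (b : bool) (s t : R) : Vec :=
  fun i => Series (fun n => flow_coef X0 n b s i * t ^ n).

(* The factor [1/4] leaves room for re-expanding at any [t] with [|t| < eps]. *)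
Definition flow_radius (X0 : bool -> R -> Vec) (s eps : R) : Prop :=
  exists M K L, 0 <= M /\ 0 <= K /\ 0 <= L /\ K * eps <= 1 / 2 /\ L * eps <= 1 / 4 /\
    forall b i, (i < 7)%nat -> exists c : nat -> nat -> R,
      (forall m n, Rabs (c m n) <= M * K ^ m * L ^ n) /\
      forall n, pow_sum (fun m => c m n) (fun x => flow_coef X0 n b (s + x) i) eps.

Lemma exists_flow_radius (X0 : bool -> R -> Vec) (a b : R) :
  (forall c i s, (i < 7)%nat -> a <= s <= b -> analytic1_at (fun x => X0 c x i) s) ->
  exists eps, 0 < eps /\ forall s, a <= s <= b -> flow_radius X0 s eps.
Proof.
  intros H.
  destruct (common_radius (fun c i d => forall s, a <= s <= b ->
     maj (fun x => X0 c x i) s (/ d) (/ d) 1) 7) as (d & Hd & Hmaj).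
  - intros c i d d' Hdd Hm s Hs. apply maj_shrink with d; auto.
  - intros c i Hi. apply analytic1_uniform_maj. intros s Hs. now apply H.
  - set (K := / d) in *. assert (HK : 0 < K) by now apply Rinv_0_lt_compat.
    set (E := 32928 * K * K).
    assert (HE : 0 < E) by (unfold E; repeat apply Rmult_lt_0_compat; lra).
    (* Chosen for the ratios [2 K] and [4 E] below: [2 K eps <= 1 / 2] and [4 E eps <= 1 / 4]. *)
    set (eps := Rmin (/ (4 * K)) (/ (16 * E))).
    assert (He1 : eps <= / (4 * K)) by apply Rmin_l.
    assert (He2 : eps <= / (16 * E)) by apply Rmin_r.
    assert (HeK : K * eps <= 1 / 4).
    { replace (1 / 4) with (K * / (4 * K)) by (field; lra).
      apply Rmult_le_compat_l; lra. }
    assert (HeE : E * eps <= 1 / 16).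
    { replace (1 / 16) with (E * / (16 * E)) by (field; lra).
      apply Rmult_le_compat_l; lra. }
    exists eps. split.
    { apply Rmin_glb_lt; apply Rinv_0_lt_compat; lra. }
    (* From [hc (2 n + 1) m <= 2^(2 n + 1 + m)]: one factor 2 goes into the constant, [2^m] into the
       ratio in [x], and [4^n] into the ratio in [t]. *)
    intros s Hs. exists (2 * K), (2 * K), (4 * E). repeat split; try lra.
    intros c i Hi.
    assert (Hn : forall n, maj (fun x => flow_coef X0 n c x i) s K (K * E ^ n * sqw n) (2 * n + 1)).
    { intros n. apply flow_coef_maj; auto. lra. }
    set (cc := fun n => proj1_sig (constructive_indefinite_description _ (Hn n))).
    assert (Hcc : forall n, (forall m, Rabs (cc n m) <= K * E ^ n * sqw n * (K ^ m * hc (2 * n + 1) m))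
      /\ pow_sum (cc n) (fun x => flow_coef X0 n c (s + x) i) (/ K)).
    { intros n. exact (proj2_sig (constructive_indefinite_description _ (Hn n))). }
    exists (fun m n => cc n m). split.
    + intros m n. apply Rle_trans with (1 := proj1 (Hcc n) m).
      apply Rle_trans with (K * E ^ n * 1 * (K ^ m * 2 ^ (2 * n + 1 + m))).
      * assert (Hh := hc_bounds (2 * n + 1) m). assert (Hw := sqw_pos n).
        assert (Hw1 : sqw n <= 1).
        { unfold sqw. rewrite <- Rinv_1. apply Rinv_le_contravar; [lra|].
          apply pow_R1_Rle. rewrite S_INR. generalize (pos_INR n). lra. }
        assert (HKm : 0 < K ^ m) by now apply pow_lt.
        assert (HEn : 0 < K * E ^ n) by (apply Rmult_lt_0_compat; auto; now apply pow_lt).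
        apply Rmult_le_compat.
        -- apply Rmult_le_pos; lra.
        -- apply Rmult_le_pos; lra.
        -- apply Rmult_le_compat_l; lra.
        -- apply Rmult_le_compat_l; lra.
      * apply Req_le. rewrite !pow_add, pow_mult, !Rpow_mult_distr.
        replace (2 ^ 2) with 4 by ring. ring.
    + intros n. apply pow_sum_le with (/ K); [|apply Hcc].
      apply Rle_trans with (1 := He1). apply Rinv_le_contravar; lra.
Qed.

Lemma flow_sum_expands (X0 : bool -> R -> Vec) (s eps : R) (b : bool) (i : nat) :
  0 < eps -> flow_radius X0 s eps -> (i < 7)%nat ->
  exists c, expands (fun s t => flow_sum X0 b s t i) s 0 c eps /\
    forall n, pow_sum (fun m => c m n) (fun x => flow_coef X0 n b (s + x) i) eps.
Proof.
  intros Heps (M & K & L & HM & HK & HL & HKe & HLe & H) Hi.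
  destruct (H b i Hi) as (c & Hc & Hs). exists c. split; auto.
  intros x y Hx Hy.
  assert (Hq : forall N q z, 0 <= N -> N * eps <= q -> q < 1 -> Rabs z < eps -> 0 <= N * Rabs z < 1).
  { intros N q z HN HNq Hq Hz. assert (Hp := Rabs_pos z). split.
    - now apply Rmult_le_pos.
    - apply Rle_lt_trans with (N * eps); [|lra]. apply Rmult_le_compat_l; lra. }
  split.
  - apply abs_double_prod with
      (u := fun n => M * (L * Rabs y) ^ n) (v := fun m => 1 * (K * Rabs x) ^ m).
    + intros n m. rewrite !Rabs_mult, <- !RPow_abs, !Rpow_mult_distr.
      replace (M * (L ^ n * Rabs y ^ n) * (1 * (K ^ m * Rabs x ^ m)))
        with (M * K ^ m * L ^ n * Rabs x ^ m * Rabs y ^ n) by ring.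
      repeat apply Rmult_le_compat_r; auto using pow_le, Rabs_pos.
    + apply ex_series_geom_scal. apply (Hq L (1 / 4)); auto; lra.
    + apply ex_series_geom_scal. apply (Hq K (1 / 2)); auto; lra.
  - unfold flow_sum. apply Series_ext. intros n. rewrite Rplus_0_l, Series_scal_r.
    f_equal. symmetry. apply is_series_unique. now apply Hs.
Qed.

(** The coefficients are already centred at [s], so only [t] is moved. Recentring with radius [eps]
    is possible because [L (|t| + eps) <= 2 L eps <= 1 / 2], and the new ratio in [t] is [/ eps]. *)
Lemma flow_sum_analytic (X0 : bool -> R -> Vec) (s t eps : R) (b : bool) (i : nat) :
  flow_radius X0 s eps -> Rabs t < eps -> (i < 7)%nat ->
  analytic2_at (fun s t => flow_sum X0 b s t i) s t.
Proof.
  intros (M & K & L & HM & HK & HL & HKe & HLe & H) Ht Hi.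
  assert (Heps : 0 < eps) by (generalize (Rabs_pos t); lra).
  destruct (H b i Hi) as (c & Hc & Hs).
  assert (Hq : L * (Rabs t + eps) < 1).
  { apply Rle_lt_trans with (L * (2 * eps)); [|lra]. apply Rmult_le_compat_l; lra. }
  destruct (recenter2 c M K L t eps HM HK HL Hc Heps Hq) as [H1 H2].
  apply analytic2_at_of_geo_bound with (1 := HK) (3 := H1) (4 := Heps).
  - apply Rlt_le, Rinv_0_lt_compat, Heps.
  - lra.
  - rewrite Rinv_l; lra.
  - intros x y Hx Hy. rewrite <- H2.
    + unfold flow_sum. apply Series_ext. intros n.
      replace (t + (y - t)) with y by ring. f_equal.
      symmetry. apply is_series_unique.
      replace (flow_coef X0 n b x i) with (flow_coef X0 n b (s + (x - s)) i)
        by (f_equal; ring). now apply Hs.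
    + apply Rle_lt_trans with (K * eps); [|lra]. apply Rmult_le_compat_l; lra.
    + lra.
Qed.

(** * Uniqueness and geometry of solutions *)

(** Both derivatives exist, so a difference quotient taken inside the interval determines them, even
    at an endpoint. *)
Lemma Derive_eq_on_interval (f g : R -> R) (a b s : R) :
  a < b -> a <= s <= b -> ex_derive f s -> ex_derive g s ->
  (forall x, a <= x <= b -> f x = g x) -> Derive f s = Derive g s.
Proof.
  intros Hab Hs Hf Hg E.
  assert (Hd : is_derive (fun x => f x - g x) s (Derive f s - Derive g s)).
  { apply (is_derive_minus f g); now apply Derive_correct. }
  apply is_derive_Reals in Hd. set (l := Derive f s - Derive g s) in *.
  destruct (Req_dec l 0) as [H|H]; [unfold l in H; lra|]. exfalso.
  assert (Hl := Rabs_pos_lt _ H).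
  destruct (Hd _ Hl) as [[d Hd0] Hd']. simpl in Hd'.
  (* The increment points into [[a,b]]: to the left at [b], to the right elsewhere. *)
  assert (Hh : exists h, h <> 0 /\ Rabs h < d /\ a <= s + h <= b).
  { destruct (Rle_lt_dec b s) as [Hbs|Hbs].
    - exists (- Rmin (d / 2) (b - a)).
      assert (A := Rmin_l (d / 2) (b - a)). assert (B := Rmin_r (d / 2) (b - a)).
      assert (0 < Rmin (d / 2) (b - a)) by (apply Rmin_glb_lt; lra).
      rewrite Rabs_Ropp, Rabs_pos_eq by lra. repeat split; lra.
    - exists (Rmin (d / 2) (b - s)).
      assert (A := Rmin_l (d / 2) (b - s)). assert (B := Rmin_r (d / 2) (b - s)).
      assert (0 < Rmin (d / 2) (b - s)) by (apply Rmin_glb_lt; lra).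
      rewrite Rabs_pos_eq by lra. repeat split; lra. }
  destruct Hh as (h & Hh0 & Hhd & Hsh).
  specialize (Hd' h Hh0 Hhd). rewrite (E (s + h)), (E s) in Hd' by auto.
  replace ((g (s + h) - g (s + h) - (g s - g s)) / h - l) with (- l) in Hd' by (field; auto).
  rewrite Rabs_Ropp in Hd'. lra.
Qed.

Lemma flow_coef_ex_derive (X0 : bool -> R -> Vec) (s eps : R) (n : nat) (b : bool) (i : nat) :
  0 < eps -> flow_radius X0 s eps -> (i < 7)%nat ->
  ex_derive (fun x => flow_coef X0 n b x i) s.
Proof.
  intros Heps H Hi. destruct (flow_sum_expands X0 s eps b i Heps H Hi) as (c & _ & Hc).
  assert (H0 : Rabs 0 < eps) by now rewrite Rabs_R0.
  assert (D := pow_sum_is_derive _ _ _ _ (Hc n) H0).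
  apply (is_derive_shift (fun x => flow_coef X0 n b x i)) in D.
  rewrite Rplus_0_r in D. eexists. exact D.
Qed.

Lemma flow_sum_t_expansion (X0 : bool -> R -> Vec) (s eps : R) (b : bool) (i : nat) :
  0 < eps -> flow_radius X0 s eps -> (i < 7)%nat ->
  t_expansion (fun s t => flow_sum X0 b s t i) s eps /\
  forall n, tcoef (fun s t => flow_sum X0 b s t i) n s = flow_coef X0 n b s i.
Proof.
  intros Heps H Hi. destruct (flow_sum_expands X0 s eps b i Heps H Hi) as (c & Hf & Hc).
  destruct (expands_tcoef _ _ _ _ Heps Hf) as [H1 H2]. split; auto.
  intros n. rewrite H2, <- (pow_sum_0 _ _ _ Heps (Hc n)). now rewrite Rplus_0_r.
Qed.

Section Flow.
Variables (a b eps : R) (X0 : bool -> R -> Vec).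
Hypotheses (Hab : a < b) (Heps : 0 < eps).
Hypothesis Hrad : forall s, a <= s <= b -> flow_radius X0 s eps.

Lemma dom_Rabs (s t : R) : dom a b eps s t <-> a <= s <= b /\ Rabs t < eps.
Proof.
  unfold dom. split; intros [H1 H2]; split; auto.
  - apply Rabs_def1; lra.
  - apply Rabs_def2 in H2. lra.
Qed.

(** Lets the recursion pass through the derivative in [s], although the coefficients are known to
    agree on [[a,b]] only. *)
Lemma Derive_tcoef_flow (f : R -> R -> R) (n : nat) (c : bool) (i : nat) (s : R) :
  (i < 7)%nat -> a <= s <= b -> ex_derive (tcoef f n) s ->
  (forall x, a <= x <= b -> tcoef f n x = flow_coef X0 n c x i) ->
  Derive (tcoef f n) s = Derive (fun x => flow_coef X0 n c x i) s.
Proof.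
  intros Hi Hs Hex E. apply Derive_eq_on_interval with a b; auto.
  apply flow_coef_ex_derive with eps; auto.
Qed.

Lemma flow_sum_solves (c : bool) (s t : R) :
  dom a b eps s t ->
  veq (Dt (flow_sum X0 c) s t) (cross7 (flow_sum X0 true s t) (Ds (flow_sum X0 c) s t)).
Proof.
  intros Hd i Hi. apply dom_Rabs in Hd. destruct Hd as [Hs Ht].
  assert (HT : forall d j, (j < 7)%nat -> _) by
    (intros d j Hj; exact (flow_sum_t_expansion X0 s eps d j Heps (Hrad s Hs) Hj)).
  destruct (HT c i Hi) as [(H1 & _) E1].
  assert (HL := pow_sum_derive _ _ _ H1 t Ht).
  assert (HR : pow_sum (fun n => conv7 (fun l => flow_coef X0 l true s)
        (fun l j => Derive (fun s' => flow_coef X0 l c s' j) s) n i)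
      (fun t => cross7 (flow_sum X0 true s t) (Ds (flow_sum X0 c) s t) i) eps).
  { apply (pow_sum_cross7 (fun l => flow_coef X0 l true s)
      (fun l j => Derive (fun s' => flow_coef X0 l c s' j) s)
      (flow_sum X0 true s) (Ds (flow_sum X0 c) s)).
    - intros j Hj. destruct (HT true j Hj) as [(HA & _) E].
      apply pow_sum_ext with (3 := HA); auto.
    - intros j Hj. destruct (HT c j Hj) as [(_ & HA & _ & Hex) E].
      apply pow_sum_ext with (3 := HA); auto.
      intros n. apply Derive_tcoef_flow; auto. intros x Hx.
      now apply (flow_sum_t_expansion X0 x eps c j Heps (Hrad x Hx) Hj). }
  specialize (HR t Ht).
  change (Dt (flow_sum X0 c) s t i) with (Derive (fun t' => flow_sum X0 c s t' i) t).
  rewrite <- (is_series_unique _ _ HL), <- (is_series_unique _ _ HR).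
  apply Series_ext. intros n. f_equal. unfold PS_derive.
  rewrite E1, flow_coef_S. rewrite <- Rmult_assoc, Rinv_r, Rmult_1_l; auto.
  apply not_0_INR. lia.
Qed.

Lemma flow_sum_initial (c : bool) (s : R) (i : nat) : flow_sum X0 c s 0 i = X0 c s i.
Proof.
  unfold flow_sum. change (PSeries (fun n => flow_coef X0 n c s i) 0 = X0 c s i).
  apply PSeries_0.
Qed.

Lemma flow_sum_ex_derive_s (c : bool) (s t : R) (i : nat) :
  dom a b eps s t -> (i < 7)%nat -> ex_derive (fun s' => flow_sum X0 c s' t i) s.
Proof.
  intros Hd Hi. apply dom_Rabs in Hd. destruct Hd as [Hs Ht].
  destruct (flow_sum_t_expansion X0 s eps c i Heps (Hrad s Hs) Hi) as [(_ & _ & H & _) _].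
  auto.
Qed.

Lemma flow_sum_is_derive_t (c : bool) (s t : R) (i : nat) :
  dom a b eps s t -> (i < 7)%nat ->
  is_derive (fun t' => flow_sum X0 c s t' i) t (Dt (flow_sum X0 c) s t i).
Proof.
  intros Hd Hi. apply dom_Rabs in Hd. destruct Hd as [Hs Ht].
  destruct (flow_sum_t_expansion X0 s eps c i Heps (Hrad s Hs) Hi) as [(H & _) _].
  apply Derive_correct. eexists. now apply pow_sum_is_derive with (1 := H).
Qed.

Section Uniqueness.
Variable X : bool -> R -> R -> Vec.
Hypothesis Hana : forall c, vanalytic2_on (dom a b eps) (X c).
Hypothesis Hini : forall c s, a <= s <= b -> veq (X c s 0) (X0 c s).
Hypothesis Heq : forall c s t, dom a b eps s t ->
  veq (Dt (X c) s t) (cross7 (X true s t) (Ds (X c) s t)).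

Lemma dom_0 (s : R) : a <= s <= b -> dom a b eps s 0.
Proof. intros Hs. split; [auto | lra]. Qed.

(** The radius [rho] depends on [s] and may be smaller than [eps]; for each fixed [s] the identity
    theorem in [t] later covers the rest of the interval. *)
Lemma solution_t_expansion (s : R) :
  a <= s <= b -> exists rho, 0 < rho <= eps /\
    forall c i, (i < 7)%nat -> t_expansion (fun s t => X c s t i) s rho.
Proof.
  intros Hs.
  destruct (common_radius (fun c i rho => t_expansion (fun s t => X c s t i) s rho) 7)
    as (rho & Hrho & H).
  - intros c i d d' Hd. apply t_expansion_le. lra.
  - intros c i Hi. apply analytic2_t_expansion. apply (Hana c s 0); auto. now apply dom_0.
  - exists (Rmin rho eps). split.
    + split; [now apply Rmin_glb_lt | apply Rmin_r].
    + intros c i Hi. apply t_expansion_le with rho; auto. apply Rmin_l.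
Qed.

(** The induction treats all [s] in [[a,b]] at once, since its step differentiates the earlier
    coefficients in [s]. *)
Lemma solution_tcoef (n : nat) (c : bool) (s : R) (i : nat) :
  a <= s <= b -> (i < 7)%nat -> tcoef (fun s t => X c s t i) n s = flow_coef X0 n c s i.
Proof.
  revert c s i. induction n as [n IH] using (well_founded_ind Nat.lt_wf_0).
  intros c s i Hs Hi.
  destruct (solution_t_expansion s Hs) as (rho & [Hrho Hle] & HT).
  destruct (HT c i Hi) as (H1 & _).
  destruct n as [|n].
  - rewrite <- (pow_sum_0 _ _ _ Hrho H1). now apply Hini.
  - assert (HR : pow_sum (fun n => conv7 (fun l j => tcoef (fun s t => X true s t j) l s)
          (fun l j => Derive (tcoef (fun s t => X c s t j) l) s) n i)
        (fun t => cross7 (X true s t) (Ds (X c) s t) i) rho).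
    { apply (pow_sum_cross7 (fun l j => tcoef (fun s t => X true s t j) l s)
        (fun l j => Derive (tcoef (fun s t => X c s t j) l) s) (X true s) (Ds (X c) s)).
      - intros j Hj. now destruct (HT true j Hj) as (HA & _).
      - intros j Hj. now destruct (HT c j Hj) as (_ & HA & _). }
    assert (HL : pow_sum (PS_derive (fun n => tcoef (fun s t => X c s t i) n s))
        (fun t => cross7 (X true s t) (Ds (X c) s t) i) rho).
    { apply pow_sum_ext with (3 := pow_sum_derive _ _ _ H1); auto.
      intros t Ht. apply (Heq c s t); auto. apply dom_Rabs. split; auto. lra. }
    (* Both sides of the flow equation are now power series in [t]; index [n] on the left carries
       [(n + 1)] times coefficient [n + 1]. *)
    assert (E := pow_sum_unique _ _ _ _ Hrho HL HR n). unfold PS_derive in E.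
    rewrite flow_coef_S.
    rewrite (conv7_ext _ (fun l j => tcoef (fun s t => X true s t j) l s)
      _ (fun l j => Derive (tcoef (fun s t => X c s t j) l) s)).
    + rewrite <- E. field. apply not_0_INR. lia.
    + intros l Hl j Hj. symmetry. apply IH; auto. lia.
    + intros l Hl j Hj. symmetry. apply Derive_tcoef_flow; auto.
      * now destruct (HT c j Hj) as (_ & _ & _ & HA).
      * intros x Hx. apply IH; auto. lia.
Qed.

Lemma solution_unique (c : bool) (s t : R) :
  dom a b eps s t -> veq (X c s t) (flow_sum X0 c s t).
Proof.
  intros [Hs Ht] i Hi.
  apply Rminus_diag_uniq.
  destruct (solution_t_expansion s Hs) as (rho & [Hrho Hle] & HT).
  destruct (HT c i Hi) as (H1 & _).
  destruct (flow_sum_t_expansion X0 s eps c i Heps (Hrad s Hs) Hi) as [(H2 & _) E].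
  apply (analytic_zero (fun t => X c s t i - flow_sum X0 c s t i) eps rho); auto.
  - intros u Hu. rewrite <- (is_series_unique _ _ (H1 u Hu)).
    rewrite <- (is_series_unique _ _ (H2 u ltac:(lra))).
    apply Rminus_diag_eq, Series_ext. intros n. f_equal.
    rewrite E. now apply solution_tcoef.
  - intros u Hu. assert (Hd : dom a b eps s u) by (split; auto).
    destruct (analytic2_slice (fun s t => X c s t i) s u) as (p & r & Hr & Hp).
    { now apply Hana. }
    destruct (analytic2_slice (fun s t => flow_sum X0 c s t i) s u) as (q & r' & Hr' & Hq).
    { apply flow_sum_analytic with eps; auto. now apply dom_Rabs in Hd. }
    exists (fun n => p n + -1 * q n), (Rmin r r'). split; [now apply Rmin_glb_lt|].
    apply pow_sum_ext with (c := fun n => p n + -1 * q n)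
      (f := fun x => X c s (u + x) i + -1 * flow_sum X0 c s (u + x) i); auto.
    + intros x _. ring.
    + apply pow_sum_plus.
      * apply pow_sum_le with r; auto. apply Rmin_l.
      * apply (pow_sum_scal (-1) q (fun x => flow_sum X0 c s (u + x) i)).
        apply pow_sum_le with r'; auto. apply Rmin_r.
Qed.

End Uniqueness.
End Flow.

(** * Algebra of the cross product and the associative form *)

Lemma dot7_veq (u u' v v' : Vec) : veq u u' -> veq v v' -> dot7 u v = dot7 u' v'.
Proof. intros Hu Hv. apply sum_eq. intros i Hi. rewrite Hu, Hv by lia. reflexivity. Qed.

Lemma norm7_one (u : Vec) : norm7 u = 1 <-> dot7 u u = 1.
Proof.
  unfold norm7. split; intros H.
  - assert (Hp : 0 <= dot7 u u).
    { apply cond_pos_sum. intros. apply Rle_0_sqr. }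
    rewrite <- (sqrt_sqrt _ Hp), H. ring.
  - rewrite H. apply sqrt_1.
Qed.

Ltac expand7 :=
  unfold dot7, cross7, G2phi, dx, det3; cbn [sum_f_R0 Nat.sub basis7 Nat.eqb].

Lemma dot7_cross7_l (u v : Vec) : dot7 u (cross7 u v) = 0.
Proof. expand7. ring. Qed.

Lemma dot7_cross7_r (u v : Vec) : dot7 v (cross7 u v) = 0.
Proof. expand7. ring. Qed.

(** Lagrange's identity for the cross product, a polynomial identity in fourteen coordinates. *)
Lemma dot7_cross7_cross7 (u v : Vec) :
  dot7 (cross7 u v) (cross7 u v) = dot7 u u * dot7 v v - dot7 u v ^ 2.
Proof. expand7. ring. Qed.

Lemma G2phi_dot7 (u v w : Vec) : G2phi u v w = dot7 (cross7 u v) w.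
Proof. expand7. ring. Qed.

Lemma dot7_sym (u v : Vec) : dot7 u v = dot7 v u.
Proof. apply sum_eq. intros. ring. Qed.

(** Since [cross7 u v] is orthogonal to [u] and [v], the Gram matrix is block diagonal. By
    Lagrange's identity both blocks have determinant [w = |u x v|^2], so the volume is the square
    root of [w * w]. *)
Lemma G2phi_vol3_cross7 (u v : Vec) :
  dot7 u u = 1 -> G2phi u v (cross7 u v) = vol3 u v (cross7 u v).
Proof.
  intros Hu. rewrite G2phi_dot7. unfold vol3.
  rewrite !(dot7_sym (cross7 u v) u), !(dot7_sym (cross7 u v) v), (dot7_sym v u).
  rewrite dot7_cross7_l, dot7_cross7_r.
  assert (Hp : 0 <= dot7 (cross7 u v) (cross7 u v)).
  { apply cond_pos_sum. intros. apply Rle_0_sqr. }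
  assert (E := dot7_cross7_cross7 u v). rewrite Hu in *.
  set (w := dot7 (cross7 u v) (cross7 u v)) in *.
  rewrite <- (sqrt_square w) at 1 by auto. f_equal. unfold det3. rewrite E. ring.
Qed.

Lemma vol3_veq (u u' v v' w w' : Vec) :
  veq u u' -> veq v v' -> veq w w' -> vol3 u v w = vol3 u' v' w'.
Proof.
  intros Hu Hv Hw. unfold vol3.
  rewrite (dot7_veq u u' u u'), (dot7_veq u u' v v'), (dot7_veq u u' w w'),
    (dot7_veq v v' u u'), (dot7_veq v v' v v'), (dot7_veq v v' w w'),
    (dot7_veq w w' u u'), (dot7_veq w w' v v'), (dot7_veq w w' w w'); auto.
Qed.

Lemma G2phi_veq (u u' v v' w w' : Vec) :
  veq u u' -> veq v v' -> veq w w' -> G2phi u v w = G2phi u' v' w'.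
Proof.
  intros Hu Hv Hw. rewrite !G2phi_dot7. apply dot7_veq; auto.
  intros i Hi. now apply cross7_ext.
Qed.

Lemma is_derive_dot7_self (u : R -> Vec) (u' : Vec) (t : R) :
  (forall i, (i < 7)%nat -> is_derive (fun t => u t i) t (u' i)) ->
  is_derive (fun t => dot7 (u t) (u t)) t (2 * dot7 (u t) u').
Proof.
  intros H. unfold dot7. rewrite scal_sum.
  assert (G : forall N, (N < 7)%nat -> is_derive (fun t => sum_f_R0 (fun i => u t i * u t i) N) t
    (sum_f_R0 (fun i => u t i * u' i * 2) N)); [|apply G; lia].
  assert (Hsq : forall i, (i < 7)%nat ->
     is_derive (fun t => u t i * u t i) t (u t i * u' i * 2)).
  { intros i Hi. replace (u t i * u' i * 2) with (u' i * u t i + u t i * u' i) by ring.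
    apply (is_derive_mult (fun t => u t i) (fun t => u t i)); auto.
    intros; apply Rmult_comm. }
  intros N. induction N as [|N IH]; intros HN; simpl.
  - now apply Hsq.
  - apply (is_derive_plus (fun t => sum_f_R0 (fun i => u t i * u t i) N)
      (fun t => u t (S N) * u t (S N))); [apply IH; lia | now apply Hsq].
Qed.

Lemma direction_norm (a b eps s t : R) (phi : R -> R -> Vec) :
  (forall s t i, dom a b eps s t -> (i < 7)%nat ->
     is_derive (fun t' => phi s t' i) t (Dt phi s t i)) ->
  (forall s t, dom a b eps s t -> veq (Dt phi s t) (cross7 (phi s t) (Ds phi s t))) ->
  norm7 (phi s 0) = 1 -> dom a b eps s t -> norm7 (phi s t) = 1.
Proof.
  intros Hd Heq H0 [Hs Ht]. apply norm7_one in H0. apply norm7_one. rewrite <- H0.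
  assert (Hder : forall u, - eps < u < eps ->
     is_derive (fun u => dot7 (phi s u) (phi s u)) u zero).
  { intros u Hu. assert (Hdu : dom a b eps s u) by (split; auto).
    assert (D := is_derive_dot7_self (phi s) (Dt phi s u) u ltac:(auto)).
    rewrite (dot7_veq _ (phi s u) _ _ (fun _ _ => eq_refl) (Heq s u Hdu)), dot7_cross7_l,
      Rmult_0_r in D. exact D. }
  (* [eq_is_derive] is applied on an interval with ordered endpoints, so the sign of [t] decides
     which one is used. *)
  destruct (Rtotal_order t 0) as [H|[->|H]]; auto.
  - apply (eq_is_derive (fun u => dot7 (phi s u) (phi s u)) t 0); auto.
    intros u Hu. apply Hder. lra.
  - symmetry. apply (eq_is_derive (fun u => dot7 (phi s u) (phi s u)) 0 t); auto.
    intros u Hu. apply Hder. lra.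
Qed.

Lemma ruled_is_associative (a b eps : R) (phi psi : R -> R -> Vec) :
  (forall s t, dom a b eps s t -> norm7 (phi s t) = 1) ->
  flow_eqs a b eps phi psi ->
  (forall s t i, dom a b eps s t -> (i < 7)%nat ->
     (ex_derive (fun s' => phi s' t i) s /\ ex_derive (fun s' => psi s' t i) s) /\
     (ex_derive (fun t' => phi s t' i) t /\ ex_derive (fun t' => psi s t' i) t)) ->
  ruled_associative a b eps phi psi.
Proof.
  intros Hn Heq Hex r s t Hd. cbv zeta.
  set (W := fun i => r * Ds phi s t i + Ds psi s t i).
  assert (Hr : veq (fun i => Derive (fun r' => ruledF phi psi r' s t i) r) (phi s t)).
  { intros i Hi. apply is_derive_unique. unfold ruledF. auto_derive; auto. ring. }
  assert (Hs : veq (fun i => Derive (fun s' => ruledF phi psi r s' t i) s) W).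
  { intros i Hi. destruct (Hex s t i Hd Hi) as [[H1 H2] _]. unfold ruledF, W, Ds.
    rewrite Derive_plus, Derive_scal; auto. now apply (ex_derive_scal (fun s' => phi s' t i)). }
  (* Both equations have the same left factor [phi], so linearity in the second slot combines them
     into [F_t = phi x F_s]. *)
  assert (Ht : veq (fun i => Derive (fun t' => ruledF phi psi r s t' i) t)
                   (cross7 (phi s t) W)).
  { intros i Hi. destruct (Hex s t i Hd Hi) as [_ [H1 H2]].
    destruct (Heq s t Hd) as [E1 E2].
    unfold ruledF. rewrite Derive_plus, Derive_scal; auto.
    - specialize (E1 i Hi). specialize (E2 i Hi). unfold Dt in E1, E2. rewrite E1, E2.
      unfold W, cross7, G2phi, dx, det3. ring.
    - now apply (ex_derive_scal (fun t' => phi s t' i)). }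
  rewrite (G2phi_veq _ _ _ _ _ _ Hr Hs Ht), (vol3_veq _ _ _ _ _ _ Hr Hs Ht).
  apply G2phi_vol3_cross7, norm7_one, Hn, Hd.
Qed.

Theorem theorem6p5 (a b : R) (phi0 psi0 : R -> Vec) :
  a < b ->
  vanalytic1_on (fun s => a <= s <= b) phi0 ->
  (forall s, a <= s <= b -> norm7 (phi0 s) = 1) ->
  vanalytic1_on (fun s => a <= s <= b) psi0 ->
  exists eps : R, 0 < eps /\
    exists phi psi : R -> R -> Vec,
      is_solution a b eps phi0 psi0 phi psi /\
      (forall phi' psi' : R -> R -> Vec,
         is_solution a b eps phi0 psi0 phi' psi' ->
         forall s t, dom a b eps s t ->
           veq (phi' s t) (phi s t) /\ veq (psi' s t) (psi s t)) /\
      r_oriented_ruled_associative a b eps phi psi.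
Proof.
  intros Hab Hphi Hnorm Hpsi.
  set (X0 := fun c : bool => if c then phi0 else psi0).
  destruct (exists_flow_radius X0 a b) as (eps & Heps & Hrad).
  { intros [] i s Hi Hs; [now apply Hphi | now apply Hpsi]. }
  exists eps. split; auto. exists (flow_sum X0 true), (flow_sum X0 false).
  assert (Hana : forall c, vanalytic2_on (dom a b eps) (flow_sum X0 c)).
  { intros c s t Hd i Hi. apply dom_Rabs in Hd.
    apply flow_sum_analytic with eps; auto; [apply Hrad|]; apply Hd. }
  assert (Heq : flow_eqs a b eps (flow_sum X0 true) (flow_sum X0 false)).
  { intros s t Hd. split; now apply flow_sum_solves with a b eps. }
  assert (Hini : forall c s, veq (flow_sum X0 c s 0) (X0 c s)).
  { intros c s i _. apply flow_sum_initial. }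
  assert (Hdt : forall c s t i, dom a b eps s t -> (i < 7)%nat ->
     is_derive (fun t' => flow_sum X0 c s t' i) t (Dt (flow_sum X0 c) s t i)).
  { intros. now apply flow_sum_is_derive_t with a b eps. }
  assert (Hone : forall s t, dom a b eps s t -> norm7 (flow_sum X0 true s t) = 1).
  { intros s t Hd. apply direction_norm with a b eps; auto.
    - intros s' t' Hd'. exact (proj1 (Heq s' t' Hd')).
    - apply norm7_one. rewrite (dot7_veq _ (phi0 s) _ (phi0 s)) by apply (Hini true).
      apply norm7_one, Hnorm, Hd. }
  split; [|split].
  - exact (conj (Hana true) (conj (Hana false) (conj Hone
      (conj (fun s _ => conj (Hini true s) (Hini false s)) Heq)))).
  - intros phi' psi' (A1 & A2 & _ & A4 & A5) s t Hd.
    set (X := fun c : bool => if c then phi' else psi').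
    assert (HX : forall c, veq (X c s t) (flow_sum X0 c s t)).
    { intros c. apply solution_unique with a b eps; auto.
      - intros []; auto.
      - intros [] s' Hs'; now apply A4.
      - intros [] s' t' Hd'; now apply A5. }
    split; [exact (HX true) | exact (HX false)].
  - split; auto. apply ruled_is_associative; auto.
    intros s t i Hd Hi. repeat split.
    + now apply flow_sum_ex_derive_s with a b eps.
    + now apply flow_sum_ex_derive_s with a b eps.
    + eexists; now apply Hdt.
    + eexists; now apply Hdt.
Qed.
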